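(* Let $u^\varepsilon:\mathcal{H}\times[0,\infty)\to\mathbb{R}$ ($\varepsilon>0$) be solutions of $$u_t-\operatorname{tr}\left[\left(I-\frac{\nabla_H u\otimes\nabla_H u}{|\nabla_H u|^2}\right)(\nabla_H^2u)^\ast\right]=0\quad\text{in }\mathcal{H}\times(0,\infty),$$ and suppose that $u^\varepsilon\to u$ locally uniformly in $\mathcal{H}\times[0,\infty)$ as $\varepsilon\to0$. Then $u$ is also a solution of this equation in $\mathcal{H}\times(0,\infty)$.
   Context: The Heisenberg group $\mathcal{H}$ is $\mathbb{R}^3$ with the multiplication $(p_1,p_2,p_3)\cdot(q_1,q_2,q_3)=(p_1+q_1,\,p_2+q_2,\,p_3+q_3+\tfrac12(p_1q_2-q_1p_2))$ (usual topology of $\mathbb{R}^3$). Set $X_1=\partial_{p_1}-\tfrac{p_2}{2}\partial_{p_3}$, $X_2=\partial_{p_2}+\tfrac{p_1}{2}\partial_{p_3}$, $\nabla_Hu=(X_1u,X_2u)$, and let $(\nabla_H^2u)^\ast$ be the symmetric $2\times2$ matrix with diagonal entries $X_1^2u$, $X_2^2u$ and off-diagonal entries $\tfrac12(X_1X_2u+X_2X_1u)$. Solutions are in the viscosity sense. For $\eta\in\mathbb{R}^2\setminus\{0\}$ and a symmetric $2\times 2$ matrix $Y$ put $F(\eta,Y)=-\operatorname{tr}\big((I-\frac{\eta\otimes\eta}{|\eta|^2})Y\big)$. Let $\mathcal{O}\subset\mathcal{H}\times(0,\infty)$ be open. An upper (resp. lower) semicontinuous, extended-real-valued function $u$ on $\mathcal{O}$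 is a subsolution (resp. supersolution) in $\mathcal{O}$ of $u_t+F(\nabla_Hu,(\nabla_H^2u)^\ast)=0$ if (i) $u<\infty$ (resp. $u>-\infty$) in $\mathcal{O}$; and (ii) whenever $\phi$ is a smooth function on $\mathcal{O}$ and $u-\phi$ attains a (finite) maximum (resp. minimum) over $\mathcal{O}$ at $(\hat p,\hat t)$, then at $(\hat p,\hat t)$: $\phi_t+F(\nabla_H\phi,(\nabla_H^2\phi)^\ast)\le0$ (resp. $\ge0$) if $\nabla_H\phi\ne0$; and $\phi_t\le0$ (resp. $\ge0$) if $\nabla_H\phi=0$ and $(\nabla_H^2\phi)^\ast=0$. A solution is a function that is both a subsolution and a supersolution. *)

(* Defs.v *)
From HB Require Import structures.
From mathcomp Require Import all_boot all_order all_algebra.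
From mathcomp Require Import all_classical all_reals all_analysis.

Set Implicit Arguments.
Unset Strict Implicit.
Unset Printing Implicit Defensive.

Import Order.TTheory GRing.Theory Num.Theory.
Import numFieldNormedType.Exports.

Local Open Scope classical_set_scope.
Local Open Scope ring_scope.

Section Heisenberg.
Context {R : realType}.

(* Points (p, t) of H x R. The coordinates p_1, p_2, p_3 of p are p 0 0, p 0 1
   and p 0 2%:R; the topology is the usual one. *)
Definition spacetime := ('rV[R]_3 * R)%type.

Implicit Types (O : set spacetime) (f phi : spacetime -> R).

Definition pd (i : 'I_3) f : spacetime -> R := 'D_(delta_mx 0 i, 0) f.

Definition pd_t f : spacetime -> R := 'D_(0, 1) f.

Definition X1 f : spacetime -> R :=
  fun x => pd 0 f x - x.1 0 1 / 2 * pd 2%:R f x.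

Definition X2 f : spacetime -> R :=
  fun x => pd 1 f x + x.1 0 0 / 2 * pd 2%:R f x.

Definition X (i : 'I_2) : (spacetime -> R) -> spacetime -> R :=
  if i == 0 then X1 else X2.

Definition hgrad f (x : spacetime) : 'rV[R]_2 := \row_i X i f x.

Definition hhess f (x : spacetime) : 'M[R]_2 :=
  \matrix_(i, j) ((X i (X j f) x + X j (X i f) x) / 2).

(* The Euclidean norm is written out because `|eta| is the sup norm on 'rV. *)
Definition F (eta : 'rV[R]_2) (Y : 'M[R]_2) : R :=
  - \tr ((1%:M - (\sum_i eta 0 i ^+ 2)^-1 *: (eta^T *m eta)) *m Y).

(* For O open: C^k on O, with directional derivatives in all directions. *)
Fixpoint Ck O (k : nat) f : Prop :=
  match k with
  | 0 => forall x, O x -> {for x, continuous f}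
  | k'.+1 => [/\ forall x, O x -> {for x, continuous f},
                 forall v x, O x -> derivable f x v
               & forall v, Ck O k' ('D_v f)]
  end.

Definition smooth_on O f : Prop := forall k, Ck O k f.

Implicit Types (u : spacetime -> \bar R).

(* Semicontinuity on O, for the topology induced on O. *)
Definition lsc_on O u : Prop := lower_semicontinuous (u : subspace O -> \bar R).

Definition usc_on O u : Prop := lsc_on O (fun x => - u x)%E.

Definition max_at O u phi (x : spacetime) : Prop :=
  [/\ O x, u x \is a fin_num
    & forall y, O y -> (u y - (phi y)%:E <= u x - (phi x)%:E)%E].

Definition min_at O u phi (x : spacetime) : Prop :=
  [/\ O x, u x \is a fin_num
    & forall y, O y -> (u x - (phi x)%:E <= u y - (phi y)%:E)%E].

Definition subsolution O u : Prop :=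
  [/\ usc_on O u,
      forall x, O x -> (u x < +oo)%E
    & forall phi x, smooth_on O phi -> max_at O u phi x ->
        (hgrad phi x != 0 -> pd_t phi x + F (hgrad phi x) (hhess phi x) <= 0)
        /\ (hgrad phi x = 0 -> hhess phi x = 0 -> pd_t phi x <= 0)].

Definition supersolution O u : Prop :=
  [/\ lsc_on O u,
      forall x, O x -> (-oo < u x)%E
    & forall phi x, smooth_on O phi -> min_at O u phi x ->
        (hgrad phi x != 0 -> 0 <= pd_t phi x + F (hgrad phi x) (hhess phi x))
        /\ (hgrad phi x = 0 -> hhess phi x = 0 -> 0 <= pd_t phi x)].

Definition solution O u : Prop := subsolution O u /\ supersolution O u.

Definition open_half : set spacetime := [set x | 0 < x.2].

Definition closed_half : set spacetime := [set x | 0 <= x.2].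

Definition cvg_loc_unif (D : set spacetime) (ueps : R -> spacetime -> R)
    (u : spacetime -> R) : Prop :=
  forall x, D x -> exists2 U, nbhs x U &
    {uniform U `&` D, ueps eps @[eps --> 0^'+] --> u}.

End Heisenberg.

Arguments spacetime : clear implicits.

(* Main.v *)
(* Each limit test function phi is perturbed so that the approximating solutions
   touch it from below at nearby points.  Where the horizontal gradient of phi is
   nonzero, it suffices to add a fourth power of the distance, F being continuous
   there.  Where the horizontal gradient and the symmetrized Hessian of phi vanish
   at q, such a perturbation may touch at points where the gradient vanishes but
   the Hessian does not, and there the equation gives no information.  Instead phi
   is dominated near q by a (t - s) + c w3 up to o(w1^2 + w2^2 + |w3| + |t - s|),
   where w = q^-1 p, and the test function becomes
   a (t - s) + c w3 + A ((w1^2 + w2^2)^2 + w3^2 + (t - s)^2).  Its horizontal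
   gradient vanishes only where w1 = w2 = 0, and there its symmetrized horizontal
   Hessian vanishes too.

   The definition of solutions tests global maxima only, whereas the contact
   points are local ones; this is repaired by adding a smooth function that
   vanishes near the contact point and outgrows the given solution towards the
   boundary of the half-space and at infinity.  Supersolutions are handled by
   passing to -u. *)
Require Import Defs.
From HB Require Import structures.
From mathcomp Require Import all_boot all_order all_algebra.
From mathcomp Require Import all_classical all_reals all_analysis.
From mathcomp Require Import ring lra.

Set Implicit Arguments.
Unset Strict Implicit.
Unset Printing Implicit Defensive.

Import Order.TTheory GRing.Theory Num.Theory.
Import numFieldNormedType.Exports.

Local Open Scope classical_set_scope.
Local Open Scope ring_scope.

(** * Smooth functions on space-time *)

Section Smooth.
Context {R : realType} (O : set (spacetime R)) (oO : open O).
Implicit Types (f g : spacetime R -> R) (v x : spacetime R).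

Lemma nbhs_open x : O x -> nbhs x O.
Proof. by move=> Ox; exact: open_nbhs_nbhs. Qed.

Lemma near_eq_on f g x : O x -> (forall y, O y -> f y = g y) ->
  \near x, f x = g x.
Proof. by move=> Ox fg; apply: filterS (nbhs_open Ox). Qed.

Lemma Ck_eq k f g : (forall x, O x -> f x = g x) -> Ck O k f -> Ck O k g.
Proof.
have cont h1 h2 : (forall x, O x -> h1 x = h2 x) ->
    (forall x, O x -> {for x, continuous h1}) ->
    forall x, O x -> {for x, continuous h2}.
  move=> h12 ch x Ox; rewrite /prop_for /continuous_at -(h12 _ Ox).
  by apply: cvg_trans (ch _ Ox); apply: near_eq_cvg; apply: filterS (nbhs_open Ox).
elim: k f g => [|k IH] f g fg /=; first exact: cont.
case=> cf df Df; split; first exact: cont cf.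
- move=> v x Ox; apply: near_eq_derivable (df v x Ox).
  exact: near_eq_on.
- move=> v; apply: IH (Df v) => x Ox; apply: near_eq_derive.
  exact: near_eq_on.
Qed.

Lemma Ck_continuous k f x : Ck O k f -> O x -> {for x, continuous f}.
Proof. by case: k => [|k] /=; [move=> + Ox; exact|case=> + _ _ Ox; exact]. Qed.

Lemma Ck_lift k f : Ck O k.+1 f -> Ck O k f.
Proof.
elim: k f => [|k IH] f; first by case.
by move=> [cf df Df]; split=> // v; apply: IH.
Qed.

Lemma Ck_is_derive k f v x : Ck O k.+1 f -> O x -> is_derive x v f ('D_v f x).
Proof. by move=> [_ df _] Ox; apply: derivableP; exact: df. Qed.

Lemma smooth_eq f g :
  (forall x, O x -> f x = g x) -> smooth_on O f -> smooth_on O g.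
Proof. by move=> fg sf k; exact: Ck_eq fg (sf k). Qed.

Lemma smooth_continuous f x : smooth_on O f -> O x -> {for x, continuous f}.
Proof. by move=> sf; exact: Ck_continuous (sf 0). Qed.

Lemma smooth_is_derive f v x :
  smooth_on O f -> O x -> is_derive x v f ('D_v f x).
Proof. by move=> sf; exact: Ck_is_derive (sf 1). Qed.

Lemma smooth_D f v : smooth_on O f -> smooth_on O ('D_v f).
Proof. by move=> sf k; have [_ _] := sf k.+1; apply. Qed.

Lemma smooth_linear (c : spacetime R -> R) f : continuous f ->
  (forall v x, is_derive x v f (c v)) -> smooth_on O f.
Proof.
move=> cf df [|k]; first by move=> x _; exact: cf.
split; [by move=> x _; exact: cf | by move=> v x _; case: (df v x) |].
move=> v; have -> : 'D_v f = cst (c v).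
  by apply/funext => x; rewrite (@derive_val _ _ _ _ _ _ _ (df v x)).
elim: k (c v) => [|k IH] a; first by move=> x _; exact: cvg_cst.
split=> [x _|w x _|w]; [exact: cvg_cst | exact: derivable_cst|].
have -> : 'D_w (cst a : spacetime R -> R) = cst 0.
  by apply/funext => x; rewrite derive_cst.
exact: IH.
Qed.

Lemma smooth_cst (a : R) : smooth_on O (fun=> a).
Proof.
by apply: (@smooth_linear (fun=> 0)) => x; exact: cvg_cst.
Qed.

Lemma CkD k f g : Ck O k f -> Ck O k g -> Ck O k (fun x => f x + g x).
Proof.
elim: k f g => [|k IH] f g.
  by move=> cf cg x Ox; apply: cvgD; [exact: cf|exact: cg].
move=> sf sg; have [cf df Df] := sf; have [cg dg Dg] := sg; split.
- by move=> x Ox; apply: cvgD; [exact: cf|exact: cg].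
- by move=> v x Ox; apply: derivableD; [exact: df|exact: dg].
- move=> v; apply: Ck_eq (IH _ _ (Df v) (Dg v)) => x Ox.
  by rewrite (deriveD (df v x Ox) (dg v x Ox)).
Qed.

Lemma CkM k f g : Ck O k f -> Ck O k g -> Ck O k (fun x => f x * g x).
Proof.
elim: k f g => [|k IH] f g.
  by move=> cf cg x Ox; apply: cvgM; [exact: cf|exact: cg].
move=> sf sg; have [cf df Df] := sf; have [cg dg Dg] := sg; split.
- by move=> x Ox; apply: cvgM; [exact: cf|exact: cg].
- by move=> v x Ox; apply: derivableM; [exact: df|exact: dg].
- move=> v; apply: Ck_eq (CkD (IH _ _ (Ck_lift sf) (Dg v))
    (IH _ _ (Ck_lift sg) (Df v))) => x Ox.
  by rewrite (deriveM (df v x Ox) (dg v x Ox)).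
Qed.

Lemma smoothD f g :
  smooth_on O f -> smooth_on O g -> smooth_on O (fun x => f x + g x).
Proof. by move=> sf sg k; exact: CkD. Qed.

Lemma smoothM f g :
  smooth_on O f -> smooth_on O g -> smooth_on O (fun x => f x * g x).
Proof. by move=> sf sg k; exact: CkM. Qed.

Lemma smoothZ (a : R) f : smooth_on O f -> smooth_on O (fun x => a * f x).
Proof. by move=> sf; apply: smoothM => //; exact: smooth_cst. Qed.

Lemma smoothN f : smooth_on O f -> smooth_on O (fun x => - f x).
Proof.
by move=> /(smoothZ (-1)); apply: smooth_eq => x _; rewrite mulN1r.
Qed.

Lemma smoothB f g :
  smooth_on O f -> smooth_on O g -> smooth_on O (fun x => f x - g x).
Proof. by move=> sf sg; apply: smoothD => //; exact: smoothN. Qed.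

Lemma smoothX f n : smooth_on O f -> smooth_on O (fun x => f x ^+ n).
Proof.
move=> sf; elim: n => [|n IH].
  by apply: smooth_eq (smooth_cst 1) => x _; rewrite expr0.
by apply: smooth_eq (smoothM sf IH) => x _; rewrite exprS.
Qed.

Lemma smoothV f : (forall x, O x -> f x != 0) ->
  smooth_on O f -> smooth_on O (fun x => (f x)^-1).
Proof.
move=> f0 sf; elim=> [|k IH].
  by move=> x Ox; apply: cvgV; [exact: f0|exact: smooth_continuous].
have df v x : O x -> derivable f x v by move=> Ox; case: (smooth_is_derive v sf Ox).
split.
- by move=> x Ox; apply: cvgV; [exact: f0|exact: smooth_continuous].
- by move=> v x Ox; apply: derivableV; [exact: f0|exact: df].
- move=> v; have := CkM (CkM IH IH) (smoothN (smooth_D v sf) k).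
  apply: Ck_eq => x Ox; rewrite (deriveV (f0 x Ox) (df v x Ox)).
  by rewrite /GRing.scale /= expr2 invfM mulrN mulNr.
Qed.

Lemma is_derive_line f v x (h d : R) : is_derive (h *: v + x) v f d ->
  is_derive h 1 (fun h : R => f (h *: v + x)) d.
Proof.
have E : (fun r : R => r^-1 *: (((fun h : R => f (h *: v + x)) \o shift h) (r *: 1) -
    f (h *: v + x))) = (fun r => r^-1 *: ((f \o shift (h *: v + x)) (r *: v) -
    f (h *: v + x))).
  by apply/funext => r /=; rewrite scalerDl -addrA [r *: 1]mulr1.
by move=> [df <-]; split; rewrite /derivable /derive E.
Qed.

Lemma is_derive_of_line f v x (d : R) :
  is_derive (0 : R) 1 (fun h : R => f (h *: v + x)) d -> is_derive x v f d.
Proof.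
have E : (fun r : R => r^-1 *: (((fun h : R => f (h *: v + x)) \o shift 0) (r *: 1) -
    f (0 *: v + x))) = (fun r => r^-1 *: ((f \o shift x) (r *: v) - f x)).
  by apply/funext => r /=; rewrite addr0 scale0r add0r [r *: 1]mulr1.
by move=> [+ <-]; rewrite /derivable /derive E; split.
Qed.

Lemma is_derive_comp1 (G : R -> R) f v x (a b : R) :
  is_derive (f x) 1 G a -> is_derive x v f b ->
  is_derive x v (fun y => G (f y)) (a * b).
Proof.
move=> dG df; apply: is_derive_of_line.
apply: (@is_derive1_comp R G (fun h => f (h *: v + x)) 0 a b).
  by rewrite scale0r add0r.
by apply: is_derive_line; rewrite scale0r add0r.
Qed.

Lemma smooth_comp1 (G : nat -> R -> R) f :
  (forall n (z : R), is_derive z 1 (G n) (G n.+1 z)) -> smooth_on O f ->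
  smooth_on O (fun x => G 0%N (f x)).
Proof.
move=> dG sf k; elim: k 0%N => [|k IH] n.
all: have cG x : O x -> {for x, continuous (fun x => G n (f x))}.
1,3: move=> Ox; apply: (@continuous_comp _ _ _ f (G n) x).
1,3: exact: smooth_continuous.
1,2: by apply/differentiable_continuous/derivable1_diffP; case: (dG n (f x)).
  exact: cG.
have dGf v x : O x -> is_derive x v (fun x => G n (f x)) (G n.+1 (f x) * 'D_v f x).
  by move=> Ox; apply: is_derive_comp1; exact: smooth_is_derive.
split=> //; first by move=> v x Ox; case: (dGf v x Ox).
move=> v; apply: Ck_eq (CkM (IH n.+1) (smooth_D v sf k)) => x Ox.
by rewrite (@derive_val _ _ _ _ _ _ _ (dGf v x Ox)).
Qed.

Lemma MVT_line f v x : (forall h : R, 0 <= h <= 1 -> O (h *: v + x)) ->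
  smooth_on O f ->
  exists2 c : R, 0 <= c <= 1 & f (v + x) - f x = 'D_v f (c *: v + x).
Proof.
move=> seg sf.
have dg (h : R) : 0 <= h <= 1 -> is_derive h 1 (fun h : R => f (h *: v + x))
    ('D_v f (h *: v + x)).
  by move=> h01; apply: is_derive_line; apply: smooth_is_derive => //; exact: seg.
have [||c c01] := @MVT_segment R (fun h => f (h *: v + x))
  (fun h => 'D_v f (h *: v + x)) 0 1 ler01.
- by move=> h; rewrite in_itv /= => /andP[/ltW h0 /ltW h1]; apply: dg; rewrite h0.
- apply: derivable_within_continuous => h; rewrite in_itv /= => h01.
  by case: (dg h h01).
rewrite scale1r scale0r add0r subr0 mulr1 => E.
by exists c => //; move: c01; rewrite in_itv.
Qed.

Lemma deriveZv f (a : R) v x : smooth_on O f -> O x ->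
  'D_(a *: v) f x = a * 'D_v f x.
Proof.
move=> sf Ox; apply: (@derive_val _ _ _ x (a *: v) f).
apply: is_derive_of_line.
have -> : (fun h : R => f (h *: (a *: v) + x)) =
    (fun h : R => f (h *: v + x)) \o (fun h => h * a).
  by apply/funext => h /=; rewrite scalerA.
rewrite mulrC; apply: is_derive1_comp.
  by rewrite mul0r; apply: is_derive_line; rewrite scale0r add0r; exact: smooth_is_derive.
have -> : (fun h : R => h * a) = a \*: id by apply/funext => h /=; rewrite mulrC.
by apply: is_derive_eq; rewrite [LHS]mulr1.
Qed.

End Smooth.

(** * Horizontal vector fields *)

Section Frame.
Context {R : realType}.
Implicit Types (O : set (spacetime R)) (f g : spacetime R -> R).
Implicit Types (v w x q : spacetime R).

Lemma deriveDv O f v w x : open O -> smooth_on O f -> O x ->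
  'D_(v + w) f x = 'D_v f x + 'D_w f x.
Proof.
move=> oO sf Ox.
have [+ _] := smooth_is_derive v sf Ox => /= dv.
suff dvw : h^-1 *: (f (h *: (v + w) + x) - f x) @[h --> 0^'] -->
    'D_v f x + 'D_w f x by exact: cvg_lim dvw.
have -> : (fun h : R => h^-1 *: (f (h *: (v + w) + x) - f x)) =
    (fun h : R => h^-1 *: (f (h *: v + x) - f x) +
      h^-1 *: (f (h *: w + (h *: v + x)) - f (h *: v + x))).
  apply/funext => h; rewrite -scalerDr; congr (_ *: _).
  have <- : h *: (v + w) + x = h *: w + (h *: v + x).
    by rewrite scalerDr addrA [h *: w + _]addrC.
  ring.
apply: (cvgD dv).
apply/cvgrPdist_le => e e0.
have /cvgrPdist_le/(_ e e0) cD := smooth_continuous (smooth_D w sf) Ox.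
have : nbhs x (fun y => O y /\ `|'D_w f x - 'D_w f y| <= e).
  by apply: filterI cD; exact: nbhs_open.
move=> /nbhs_ballP[d /= d0 dO].
have m0 : 0 < d / (`|v| + `|w| + 1) by rewrite divr_gt0// ltr_wpDl// addr_ge0.
near=> h.
have hn0 : h != 0 by near: h; exact: nbhs_dnbhs_neq.
have hd : `|h| < d / (`|v| + `|w| + 1).
  near: h; apply: dnbhs0_lt; exact: m0.
have inO (c : R) : 0 <= c <= 1 -> ball x d (c *: (h *: w) + (h *: v + x)).
  move=> /andP[c0 c1]; rewrite -ball_normE /= opprD opprD addrCA [x + _]addrC.
  rewrite addrNK -opprD normrN addrC.
  apply: le_lt_trans (ler_normD _ _) _; rewrite !normrZ (ger0_norm c0).
  have : c * (`|h| * `|w|) <= `|h| * `|w| by rewrite ler_piMl// mulr_ge0.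
  move: hd; rewrite ltr_pdivlMr ?ltr_wpDl ?addr_ge0// !mulrDr mulr1.
  have := normr_ge0 h; lra.
have [c c01 ->] := MVT_line (fun c h01 => (dO _ (inO c h01)).1) sf.
rewrite (deriveZv _ _ sf (dO _ (inO c c01)).1).
rewrite /GRing.scale /= mulrA mulVf// mul1r.
exact: (dO _ (inO c c01)).2.
Unshelve. all: by end_near. Qed.

Lemma is_derive_affine (c : spacetime R -> R) f v x :
  (forall h : R, f (h *: v + x) = h * c v + f x) -> is_derive x v f (c v).
Proof.
move=> fE; apply: is_derive_of_line.
have -> : (fun h : R => f (h *: v + x)) = (c v \*: id) + cst (f x).
  by apply/funext => h; rewrite fE /= mulrC.
by apply: is_derive_eq; rewrite addr0 [LHS]mulr1.
Qed.

Definition coord (i : 'I_3) : spacetime R -> R := fun x => x.1 0 i.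

Definition time : spacetime R -> R := fun x => x.2.

Lemma continuous_coord i : continuous (coord i).
Proof.
move=> x; apply: (@continuous_comp _ _ _ fst (fun M : 'rV[R]_3 => M 0 i)).
  exact: cvg_fst.
exact: coord_continuous.
Qed.

Lemma continuous_time : continuous time.
Proof. by move=> x; exact: cvg_snd. Qed.

Lemma is_derive_coord i v x : is_derive x v (coord i) (coord i v).
Proof. by apply: is_derive_affine => h; rewrite /coord /= !mxE. Qed.

Lemma is_derive_time v x : is_derive x v time (time v).
Proof. by apply: is_derive_affine => h; rewrite /time /=. Qed.

Lemma smooth_coord O i : smooth_on O (coord i).
Proof.
apply: (@smooth_linear _ _ (coord i)); first exact: continuous_coord.
by move=> v x; exact: is_derive_coord.
Qed.

Lemma smooth_time O : smooth_on O time.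
Proof.
apply: (@smooth_linear _ _ time); first exact: continuous_time.
by move=> v x; exact: is_derive_time.
Qed.

(* The vector field X_i at q, as a direction of spacetime. *)
Definition frame (i : 'I_2) (q : spacetime R) : spacetime R :=
  if i == 0 then (delta_mx 0 0, 0) + (- (coord 1 q / 2)) *: (delta_mx 0 2%:R, 0)
  else (delta_mx 0 1, 0) + (coord 0 q / 2) *: (delta_mx 0 2%:R, 0).

Lemma XE O i f x : open O -> smooth_on O f -> O x ->
  X i f x = 'D_(frame i x) f x.
Proof.
move=> oO sf Ox; rewrite /X /frame; case: ifP => _.
all: rewrite (deriveDv _ _ oO sf Ox) (deriveZv _ _ sf Ox).
  by rewrite mulNr.
by [].
Qed.

Lemma smooth_X O i f : open O -> smooth_on O f -> smooth_on O (X i f).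
Proof.
move=> oO sf; have sc (j : 'I_3) : smooth_on O (fun x => x.1 0 j / 2).
  apply: smooth_eq (smoothZ oO 2^-1 (smooth_coord O j)) => // x _.
  by rewrite mulrC.
rewrite /X; case: ifP => _.
  by apply: smoothB => //; [|apply: smoothM => //]; exact: smooth_D.
by apply: smoothD => //; [|apply: smoothM => //]; exact: smooth_D.
Qed.

Lemma X_val O i f x d : open O -> smooth_on O f -> O x ->
  is_derive x (frame i x) f d -> X i f x = d.
Proof.
move=> oO sf Ox df; rewrite (XE i oO sf Ox).
exact: (@derive_val _ _ _ _ _ _ _ df).
Qed.

Lemma X_near_eq i f g x : (\near x, f x = g x) -> X i f x = X i g x.
Proof.
by move=> fg; rewrite /X; case: ifP => _; rewrite /X1 /X2 /pd !(near_eq_derive _ fg).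
Qed.

Lemma X_D O i f g x : open O -> smooth_on O f -> smooth_on O g -> O x ->
  X i (fun y => f y + g y) x = X i f x + X i g x.
Proof.
move=> oO sf sg Ox; apply: (X_val oO _ Ox); first exact: smoothD.
by rewrite !(XE i oO _ Ox)//; apply: is_deriveD; exact: smooth_is_derive.
Qed.

Lemma X_N O i f x : open O -> smooth_on O f -> O x ->
  X i (fun y => - f y) x = - X i f x.
Proof.
move=> oO sf Ox; apply: (X_val oO _ Ox); first exact: smoothN.
by rewrite !(XE i oO _ Ox)//; apply: is_deriveN; exact: smooth_is_derive.
Qed.

Lemma hgradE f x i : hgrad f x 0 i = X i f x.
Proof. by rewrite mxE. Qed.

Lemma hhessE f x i j : hhess f x i j = (X i (X j f) x + X j (X i f) x) / 2.
Proof. by rewrite mxE. Qed.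

Lemma XX_near_eq i j f g x :
  (\near x, f x = g x) -> X i (X j f) x = X i (X j g) x.
Proof.
move=> fg; apply: X_near_eq; apply: filterS (near_join fg) => y.
exact: X_near_eq.
Qed.

Lemma jet_near_eq f g x : (\near x, f x = g x) ->
  [/\ hgrad f x = hgrad g x, hhess f x = hhess g x & pd_t f x = pd_t g x].
Proof.
move=> fg; split; last exact: near_eq_derive.
- by apply/rowP => i; rewrite !hgradE; exact: X_near_eq.
- by apply/matrixP => i j; rewrite !hhessE !(XX_near_eq _ _ fg).
Qed.

Lemma XX_D O i j f g x : open O -> smooth_on O f -> smooth_on O g -> O x ->
  X i (X j (fun y => f y + g y)) x = X i (X j f) x + X i (X j g) x.
Proof.
move=> oO sf sg Ox.
rewrite -(X_D i oO (smooth_X j oO sf) (smooth_X j oO sg) Ox).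
by apply: X_near_eq; apply: near_eq_on Ox _ => // y Oy; exact: X_D Oy.
Qed.

Lemma XX_N O i j f x : open O -> smooth_on O f -> O x ->
  X i (X j (fun y => - f y)) x = - X i (X j f) x.
Proof.
move=> oO sf Ox; rewrite -(X_N i oO (smooth_X j oO sf) Ox).
by apply: X_near_eq; apply: near_eq_on Ox _ => // y Oy; exact: X_N Oy.
Qed.

Lemma jet_D O f g x : open O -> smooth_on O f -> smooth_on O g -> O x ->
  [/\ hgrad (fun y => f y + g y) x = hgrad f x + hgrad g x,
      hhess (fun y => f y + g y) x = hhess f x + hhess g x
    & pd_t (fun y => f y + g y) x = pd_t f x + pd_t g x].
Proof.
move=> oO sf sg Ox; split.
- by apply/rowP => i; rewrite !mxE (X_D i oO sf sg Ox).
- apply/matrixP => i j; rewrite !mxE !(XX_D _ _ oO sf sg Ox).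
  by rewrite -mulrDl addrACA.
- apply: (@derive_val _ _ _ x _ (f + g)).
  by apply: is_deriveD; exact: smooth_is_derive.
Qed.

Lemma jet_N O f x : open O -> smooth_on O f -> O x ->
  [/\ hgrad (fun y => - f y) x = - hgrad f x,
      hhess (fun y => - f y) x = - hhess f x
    & pd_t (fun y => - f y) x = - pd_t f x].
Proof.
move=> oO sf Ox; split.
- by apply/rowP => i; rewrite !mxE (X_N i oO sf Ox).
- apply/matrixP => i j; rewrite !mxE !(XX_N _ _ oO sf Ox).
  by rewrite -opprD mulNr.
- apply: (@derive_val _ _ _ x _ (- f)).
  by apply: is_deriveN; exact: smooth_is_derive.
Qed.

End Frame.

Section DeriveRules.
Context {R : realType}.
Implicit Types (f g : spacetime R -> R) (x v : spacetime R).

Lemma is_derive_lamD f g x v (a b : R) : is_derive x v f a ->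
  is_derive x v g b -> is_derive x v (fun y => f y + g y) (a + b).
Proof. exact: is_deriveD. Qed.

Lemma is_derive_lamN f x v (a : R) : is_derive x v f a ->
  is_derive x v (fun y => - f y) (- a).
Proof. exact: is_deriveN. Qed.

Lemma is_derive_lamM f g x v (a b : R) : is_derive x v f a ->
  is_derive x v g b -> is_derive x v (fun y => f y * g y) (f x * b + g x * a).
Proof. exact: is_deriveM. Qed.

Lemma is_derive_lamX f x v n (a : R) : is_derive x v f a ->
  is_derive x v (fun y => f y ^+ n) (n%:R * f x ^+ n.-1 * a).
Proof. by move=> df; have := is_deriveX n df; rewrite exprfctE. Qed.

Lemma is_derive_lamC x v (a : R) : is_derive x v (fun=> a) 0.
Proof. exact: is_derive_cst. Qed.

Lemma is_derive_lin2 f g x v (a b c d : R) : is_derive x v f c ->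
  is_derive x v g d -> is_derive x v (fun y => a * f y + b * g y) (a * c + b * d).
Proof.
move=> df dg; have := is_derive_lamD (is_derive_lamM (is_derive_lamC x v a) df)
  (is_derive_lamM (is_derive_lamC x v b) dg).
by rewrite !mulr0 !addr0.
Qed.

End DeriveRules.

(** * The penalised test function *)

Section Gauge.
Context {R : realType}.
Implicit Types (q x v : spacetime R) (a c A : R).

(* The coordinates of [q^-1 * x] in the group H, and the elapsed time. *)
Definition W1 q x : R := coord 0 x - coord 0 q.
Definition W2 q x : R := coord 1 x - coord 1 q.
Definition W3 q x : R := coord 2%:R x - coord 2%:R q
  - (coord 0 q * coord 1 x - coord 1 q * coord 0 x) / 2.
Definition W4 q x : R := time x - time q.

Lemma is_derive_W1 q x v : is_derive x v (W1 q) (coord 0 v).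
Proof. by apply: is_derive_affine => h; rewrite /W1 /coord !mxE addrA. Qed.

Lemma is_derive_W2 q x v : is_derive x v (W2 q) (coord 1 v).
Proof. by apply: is_derive_affine => h; rewrite /W2 /coord !mxE addrA. Qed.

Lemma is_derive_W3 q x v : is_derive x v (W3 q)
  (coord 2%:R v - (coord 0 q * coord 1 v - coord 1 q * coord 0 v) / 2).
Proof.
pose c v := coord 2%:R v - (coord 0 q * coord 1 v - coord 1 q * coord 0 v) / 2.
by apply: (is_derive_affine (c := c)) => h; rewrite /c /W3 /coord !mxE; field.
Qed.

Lemma is_derive_W4 q x v : is_derive x v (W4 q) (time v).
Proof. by apply: is_derive_affine => h; rewrite /W4 /time /= addrA. Qed.

Lemma smooth_W O q : open O -> [/\ smooth_on O (W1 q), smooth_on O (W2 q),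
  smooth_on O (W3 q) & smooth_on O (W4 q)].
Proof.
move=> oO; have C i : smooth_on O (coord i) by exact: smooth_coord.
have K a : smooth_on O (fun=> a) by exact: smooth_cst.
split; [exact: smoothB|exact: smoothB| |apply: smoothB => //; exact: smooth_time].
apply: smoothB => //; first exact: smoothB.
apply: smoothM => //; apply: smoothB => //; exact: smoothM.
Qed.

Lemma ord2_ind (P : 'I_2 -> Prop) : P 0 -> P 1 -> forall i, P i.
Proof.
move=> P0 P1 [[|[|//]] i].
  by rewrite (_ : Ordinal i = 0) //; exact: val_inj.
by rewrite (_ : Ordinal i = 1) //; exact: val_inj.
Qed.

Lemma frameE x (i : 'I_2) : [/\ coord 0 (frame i x) = (i == 0)%:R,
  coord 1 (frame i x) = (i != 0)%:R,
  coord 2%:R (frame i x) = (if i == 0 then - coord 1 x else coord 0 x) / 2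
  & time (frame i x) = 0].
Proof.
by case: i => -[|[|//]] i; split; rewrite /frame /coord /time /= ?mxE /=; field.
Qed.

(* The penalty is of Koranyi type, so that the symmetrized horizontal Hessian
   vanishes wherever the horizontal gradient does. *)
Definition gauge q a c A x : R := a * W4 q x + c * W3 q x +
  A * ((W1 q x ^+ 2 + W2 q x ^+ 2) ^+ 2 + W3 q x ^+ 2 + W4 q x ^+ 2).

Ltac derive_tac := repeat first
  [ exact: is_derive_W1 | exact: is_derive_W2 | exact: is_derive_W3
  | exact: is_derive_W4 | exact: is_derive_lamC
  | eapply is_derive_lamD | eapply is_derive_lamN | eapply is_derive_lamX
  | eapply is_derive_lamM].

Ltac smooth_tac q := case: (smooth_W q openT) => ? ? ? ?;
  repeat first [ assumption | exact: openT | exact: smooth_cst | apply: smoothB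
  | apply: smoothD | apply: smoothN | apply: smoothX | apply: smoothM ].

Lemma smooth_gauge O q a c A : open O -> smooth_on O (gauge q a c A).
Proof.
move=> oO; case: (smooth_W q oO) => s1 s2 s3 s4; rewrite /gauge.
repeat first [ assumption | exact: smooth_cst | apply: smoothD
  | apply: smoothX | apply: smoothM ].
Qed.

Lemma pd_t_gauge q a c A x : pd_t (gauge q a c A) x = a + 2 * A * W4 q x.
Proof.
apply: (@derive_val _ _ _ x (0, 1)); apply: is_derive_eq; first by derive_tac.
by rewrite /coord /time /= !mxE; field.
Qed.

Lemma X0_gauge q a c A : X 0 (gauge q a c A) = fun x => - (c / 2) * W2 q x +
  A * (4 * ((W1 q x ^+ 2 + W2 q x ^+ 2) * W1 q x) - W3 q x * W2 q x).
Proof.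
apply/funext => x; apply: (X_val openT _ (I : setT x)).
  exact: smooth_gauge openT.
have [f0 f1 f2 f3] := frameE x 0; apply: is_derive_eq; first by derive_tac.
by rewrite f0 f1 f2 f3 /= /W1 /W2 /W3 /W4; field.
Qed.

Lemma X1_gauge q a c A : X 1 (gauge q a c A) = fun x => (c / 2) * W1 q x +
  A * (4 * ((W1 q x ^+ 2 + W2 q x ^+ 2) * W2 q x) + W3 q x * W1 q x).
Proof.
apply/funext => x; apply: (X_val openT _ (I : setT x)).
  exact: smooth_gauge openT.
have [f0 f1 f2 f3] := frameE x 1; apply: is_derive_eq; first by derive_tac.
by rewrite f0 f1 f2 f3 /= /W1 /W2 /W3 /W4; field.
Qed.

Lemma XX_gauge q a c A x (u := W1 q x) (v := W2 q x) (w := W3 q x) :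
  [/\ X 0 (X 0 (gauge q a c A)) x = A * (12 * u ^+ 2 + (4 + 2^-1) * v ^+ 2),
      X 1 (X 1 (gauge q a c A)) x = A * (12 * v ^+ 2 + (4 + 2^-1) * u ^+ 2),
      X 1 (X 0 (gauge q a c A)) x = - (c / 2) + A * ((8 - 2^-1) * (u * v) - w)
    & X 0 (X 1 (gauge q a c A)) x = c / 2 + A * ((8 - 2^-1) * (u * v) + w)].
Proof.
have [f0 f1 f2 f3] := frameE x 0; have [g0 g1 g2 g3] := frameE x 1.
split; rewrite ?X0_gauge ?X1_gauge; apply: (X_val openT _ (I : setT x));
  try by smooth_tac q.
all: apply: is_derive_eq; first by derive_tac.
all: rewrite ?(f0, f1, f2, f3, g0, g1, g2, g3) /= /u /v /w /W1 /W2 /W3 /W4.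
all: by field.
Qed.

Lemma FE (eta : 'rV[R]_2) (Y : 'M[R]_2) :
  F eta Y = (eta 0 0 ^+ 2 + eta 0 1 ^+ 2)^-1 *
    (eta 0 0 ^+ 2 * Y 0 0 + eta 0 0 * eta 0 1 * (Y 0 1 + Y 1 0) +
     eta 0 1 ^+ 2 * Y 1 1) - (Y 0 0 + Y 1 1).
Proof.
have sum2 (f : 'I_2 -> R) : \sum_i f i = f 0 + f 1.
  by rewrite 2!big_ord_recl big_ord0 addr0; congr (_ + f _); exact: val_inj.
have sum1 (f : 'I_1 -> R) : \sum_i f i = f 0.
  by rewrite big_ord_recl big_ord0 addr0.
rewrite /F /mxtrace !sum2 !mxE !sum2 !mxE !sum1 !mxE.
have [e01 e10] : ((0 : 'I_2) == 1) = false /\ ((1 : 'I_2) == 0) = false by [].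
by rewrite !eqxx e01 e10 !mulr1n !mulr0n; ring.
Qed.

Lemma F_opp (eta : 'rV[R]_2) (Y : 'M[R]_2) : F (- eta) (- Y) = - F eta Y.
Proof. by rewrite !FE !mxE; rewrite !sqrrN; ring. Qed.

Lemma F_le (eta : 'rV[R]_2) (Y : 'M[R]_2) (m : R) :
  (forall i j, `|Y i j| <= m) -> - (6 * m) <= F eta Y.
Proof.
move=> Ym; rewrite FE.
set s := eta 0 0 ^+ 2 + eta 0 1 ^+ 2.
have m0 : 0 <= m := le_trans (normr_ge0 _) (Ym 0 0).
have bd (z y : R) : `|z| <= s -> `|y| <= m -> - m <= s^-1 * (z * y).
  move=> zs ym; rewrite mulrA; have [->|s0] := eqVneq s 0.
    by rewrite invr0 !mul0r oppr_le0.
  have sp : 0 < s by rewrite lt_neqAle eq_sym s0 /s addr_ge0// sqr_ge0.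
  have z1 : `|s^-1 * z| <= 1.
    by rewrite normrM ger0_norm ?invr_ge0 ?(ltW sp)// mulrC ler_pdivrMr// mul1r.
  have : `|s^-1 * z * y| <= m.
    by rewrite normrM -[leRHS]mul1r ler_pM.
  by rewrite ler_norml => /andP[].
have e0 := sqr_ge0 (eta 0 0); have e1 := sqr_ge0 (eta 0 1).
have b00 : - m <= s^-1 * (eta 0 0 ^+ 2 * Y 0 0).
  by apply: bd => //; rewrite ger0_norm// /s lerDl.
have b11 : - m <= s^-1 * (eta 0 1 ^+ 2 * Y 1 1).
  by apply: bd => //; rewrite ger0_norm// /s lerDr.
have e01 : `|eta 0 0 * eta 0 1| <= s.
  by rewrite ler_norml /s; apply/andP; split; nra.
have b01 := bd _ _ e01 (Ym 0 1); have b10 := bd _ _ e01 (Ym 1 0).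
have := ler_norm (Y 0 0); have := ler_norm (Y 1 1).
have := Ym 0 0; have := Ym 1 1.
rewrite !mulrDr; lra.
Qed.

Lemma gauge_test q a c A x : 0 < A ->
  (hgrad (gauge q a c A) x != 0 ->
    pd_t (gauge q a c A) x +
    F (hgrad (gauge q a c A) x) (hhess (gauge q a c A) x) <= 0) ->
  (hgrad (gauge q a c A) x = 0 -> hhess (gauge q a c A) x = 0 ->
    pd_t (gauge q a c A) x <= 0) ->
  a <= 2 * A * `|W4 q x| + 78 * A * (W1 q x ^+ 2 + W2 q x ^+ 2).
Proof.
move=> A0; rewrite pd_t_gauge.
set u := W1 q x; set v := W2 q x; set w := W3 q x.
have [h00 h11 h10 h01] := XX_gauge q a c A x.
rewrite -/u -/v -/w in h00 h11 h10 h01.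
have t0 : - (2 * A * `|W4 q x|) <= 2 * A * W4 q x.
  rewrite -mulrN ler_pM2l ?mulr_gt0//.
  by have := ler_norm (- W4 q x); rewrite normrN lerNl.
have u0 := sqr_ge0 u; have v0 := sqr_ge0 v.
have r0 : 0 <= A * (u ^+ 2 + v ^+ 2) by rewrite mulr_ge0 ?addr_ge0// ltW.
have [g0|gn0] := eqVneq (hgrad (gauge q a c A) x) 0; last first.
  move=> /(_ isT) + _ => ine.
  have := @F_le (hgrad (gauge q a c A) x) (hhess (gauge q a c A) x)
    (13 * (A * (u ^+ 2 + v ^+ 2))).
  suff Y i j : `|hhess (gauge q a c A) x i j| <= 13 * (A * (u ^+ 2 + v ^+ 2)).
    by move=> /(_ Y); lra.
  have Au : 0 <= A * u ^+ 2 by rewrite mulr_ge0// ltW.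
  have Av : 0 <= A * v ^+ 2 by rewrite mulr_ge0// ltW.
  have Auv1 : A * (u * v) * 2 <= A * (u ^+ 2 + v ^+ 2).
    by rewrite -mulrA ler_pM2l//; have := sqr_ge0 (u - v); rewrite sqrrB; lra.
  have Auv2 : - (A * (u ^+ 2 + v ^+ 2)) <= A * (u * v) * 2.
    by rewrite -mulrA -mulrN ler_pM2l//; have := sqr_ge0 (u + v); rewrite sqrrD; lra.
  rewrite hhessE ler_norml.
  by elim/ord2_ind: i; elim/ord2_ind: j; rewrite ?h00 ?h11 ?h01 ?h10;
    apply/andP; split; lra.
move=> _.
have x0 : X 0 (gauge q a c A) x = 0 by rewrite -hgradE g0 mxE.
have x1 : X 1 (gauge q a c A) x = 0 by rewrite -hgradE g0 mxE.
rewrite X0_gauge -/u -/v -/w in x0; rewrite X1_gauge -/u -/v -/w in x1.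
have : A * (u ^+ 2 + v ^+ 2) ^+ 2 = 0.
  have : 4 * (A * (u ^+ 2 + v ^+ 2) ^+ 2) =
    u * (- (c / 2) * v + A * (4 * ((u ^+ 2 + v ^+ 2) * u) - w * v)) +
    v * ((c / 2) * u + A * (4 * ((u ^+ 2 + v ^+ 2) * v) + w * u)) by field.
  by rewrite x0 x1 !mulr0 addr0; lra.
move/eqP; rewrite mulf_eq0 gt_eqF//= sqrf_eq0 paddr_eq0// !sqrf_eq0.
move=> /andP[/eqP uz /eqP vz] /(_ g0) H.
have /H : hhess (gauge q a c A) x = 0.
  apply/matrixP => i j; rewrite hhessE !mxE.
  by elim/ord2_ind: i; elim/ord2_ind: j; rewrite ?h00 ?h11 ?h01 ?h10 uz vz; field.
by rewrite uz vz; lra.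
Qed.

End Gauge.

(** * Parabolic Taylor estimate *)

Section Taylor.
Context {R : realType}.
Context (O : set (spacetime R)) (oO : open O).
Implicit Types (f : spacetime R -> R) (q x v : spacetime R).

Lemma X_frame f q j x : smooth_on O f -> O x ->
  X j f x = 'D_(frame j q) f x +
    (if j == 0 then - W2 q x else W1 q x) / 2 * pd 2%:R f x.
Proof.
move=> sf Ox; rewrite /X /frame; case: ifP => _.
all: rewrite (deriveDv _ _ oO sf Ox) (deriveZv _ _ sf Ox).
all: rewrite /X1 /X2 /pd /W1 /W2 /coord.
all: move: (derive f x (delta_mx 0 2%:R, 0)) => b.
  by move: (derive f x (delta_mx 0 0, 0)) => a; ring.
by move: (derive f x (delta_mx 0 1, 0)) => a; ring.
Qed.

Lemma XX_frame f q i j : smooth_on O f -> O q ->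
  X i (X j f) q = 'D_(frame i q) ('D_(frame j q) f) q +
    (if j == 0 then - coord 1 (frame i q) else coord 0 (frame i q)) / 2
      * pd 2%:R f q.
Proof.
move=> sf Oq; rewrite (XE i oO (smooth_X j oO sf) Oq).
pose k x : R := (if j == 0 then - W2 q x else W1 q x) / 2.
rewrite (@near_eq_derive _ _ _ _
  (fun x => 'D_(frame j q) f x + k x * pd 2%:R f x)); last first.
  by apply: near_eq_on Oq _ => // x Ox; exact: X_frame.
have dk : is_derive q (frame i q) k
    ((if j == 0 then - coord 1 (frame i q) else coord 0 (frame i q)) / 2).
  rewrite /k; case: ifP => _.
    have := is_derive_lamM (is_derive_lamN (is_derive_W2 q q (frame i q)))
      (is_derive_lamC q (frame i q) 2^-1).
    by rewrite mulr0 add0r mulrC.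
  have := is_derive_lamM (is_derive_W1 q q (frame i q))
      (is_derive_lamC q (frame i q) 2^-1).
  by rewrite mulr0 add0r mulrC.
have k0 : k q = 0.
  by rewrite /k /W1 /W2 !subrr oppr0; case: ifP; rewrite mul0r.
apply: (@derive_val _ _ _ q (frame i q)).
have s2 : smooth_on O (pd 2%:R f) by exact: smooth_D.
have := is_derive_lamD
  (smooth_is_derive (frame i q) (smooth_D (frame j q) sf) Oq)
  (is_derive_lamM dk (smooth_is_derive (frame i q) s2 Oq)).
by rewrite k0 mul0r add0r [pd _ _ _ * _]mulrC.
Qed.

Lemma spacetime_eq x y :
  (forall i, coord i x = coord i y) -> time x = time y -> x = y.
Proof.
case: x y => [x1 x2] [y1 y2] xy; rewrite /time /= => ->; congr (_, _).
by apply/rowP => i; exact: xy.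
Qed.

Lemma spacetimeE q x : x = W4 q x *: (0, 1) + (W3 q x *: (delta_mx 0 2%:R, 0) +
  ((W1 q x *: frame 0 q + W2 q x *: frame 1 q) + q)).
Proof.
have [f0 f1 f2 f3] := frameE q 0; have [g0 g1 g2 g3] := frameE q 1.
have c i u v : coord i (u + v : spacetime R) = coord i u + coord i v.
  by rewrite /coord mxE.
have cz i (a : R) u : coord i (a *: u : spacetime R) = a * coord i u.
  by rewrite /coord mxE.
have t u v : time (u + v : spacetime R) = time u + time v by [].
have tz (a : R) u : time (a *: u : spacetime R) = a * time u by [].
set y := RHS.
have yE i : coord i x = coord i y.
  rewrite /y; case: i => -[|[|[|//]]] i.
  - rewrite (_ : Ordinal i = 0); last exact: val_inj.
    by rewrite !c !cz f0 g0 /= /W1 /W2 /coord /= !mxE /=; ring.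
  - rewrite (_ : Ordinal i = 1); last exact: val_inj.
    by rewrite !c !cz f1 g1 /= /W1 /W2 /coord /= !mxE /=; ring.
  - rewrite (_ : Ordinal i = 2%:R); last exact: val_inj.
    by rewrite !c !cz f2 g2 /= /W1 /W2 /W3 /coord /= !mxE /=; field.
have tE : time x = time y.
  by rewrite /y !t !tz f3 g3 /W4 /time /=; ring.
exact: spacetime_eq.
Qed.

Lemma horizontal_line f q (a b : R) x : smooth_on O f -> O x ->
  let v := a *: frame 0 q + b *: frame 1 q in
  let S i j := 'D_(frame i q) ('D_(frame j q) f) x in
  'D_v ('D_v f) x =
    a ^+ 2 * S 0 0 + a * b * (S 1 0 + S 0 1) + b ^+ 2 * S 1 1.
Proof.
move=> sf Ox v S.
have lin g y : smooth_on O g -> O y -> 'D_v g y =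
    a * 'D_(frame 0 q) g y + b * 'D_(frame 1 q) g y.
  by move=> sg Oy; rewrite (deriveDv _ _ oO sg Oy) !(deriveZv _ _ sg Oy).
have s i : smooth_on O ('D_(frame i q) f) by exact: smooth_D.
rewrite (@near_eq_derive _ _ _ _ (fun y => a * 'D_(frame 0 q) f y +
  b * 'D_(frame 1 q) f y)); last first.
  by apply: near_eq_on Ox _ => // y Oy; exact: lin.
have sl : smooth_on O (fun y => a * 'D_(frame 0 q) f y + b * 'D_(frame 1 q) f y).
  by apply: smoothD => //; apply: smoothZ.
have D i : 'D_(frame i q) (fun y => a * 'D_(frame 0 q) f y +
    b * 'D_(frame 1 q) f y) x = a * S i 0 + b * S i 1.
  apply: (@derive_val _ _ _ x (frame i q)).
  by apply: is_derive_lin2; apply: smooth_is_derive Ox; exact: s.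
rewrite (lin _ _ sl Ox) (D 0) (D 1).
by move: (S 0 0) (S 1 0) (S 0 1) (S 1 1) => s00 s10 s01 s11; ring.
Qed.

Lemma mul_near_le (e p P w : R) : `|P - p| <= e -> w * P <= p * w + e * `|w|.
Proof.
move=> Pp; rewrite -lerBlDl [p * w]mulrC -mulrBr (le_trans (ler_norm _))//.
by rewrite normrM mulrC ler_wpM2r.
Qed.

Lemma quadratic_form_le (e a b s t r c : R) : 0 <= e ->
  `|s| <= e / 2 -> `|t| <= e / 2 -> `|r| <= e / 2 -> 0 <= c <= 1 ->
  c * (a ^+ 2 * s + a * b * r + b ^+ 2 * t) <= e * (a ^+ 2 + b ^+ 2).
Proof.
move=> e0; rewrite !ler_norml.
move=> /andP[sl su] /andP[tl tu] /andP[rl ru] /andP[cl cu].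
have a1 := sqr_ge0 a; have a2 := sqr_ge0 b.
have b1 : a ^+ 2 * s <= a ^+ 2 * (e / 2) by exact: ler_wpM2l.
have b2 : b ^+ 2 * t <= b ^+ 2 * (e / 2) by exact: ler_wpM2l.
have b3 : a * b * r <= (a ^+ 2 + b ^+ 2) * (e / 2).
  have p1 : 0 <= (a - b) ^+ 2 * (e / 2 + r).
    by rewrite mulr_ge0 ?sqr_ge0//; lra.
  have p2 : 0 <= (a + b) ^+ 2 * (e / 2 - r).
    by rewrite mulr_ge0 ?sqr_ge0//; lra.
  have p3 : 0 <= (a ^+ 2 + b ^+ 2) * e by rewrite mulr_ge0 ?addr_ge0.
  lra.
have B0 : 0 <= e * (a ^+ 2 + b ^+ 2) by rewrite mulr_ge0 ?addr_ge0.
apply: (@le_trans _ _ (c * (e * (a ^+ 2 + b ^+ 2)))); last first.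
  by rewrite ler_piMl.
by rewrite ler_wpM2l//; lra.
Qed.

(* From q to x = q * w one moves along the horizontal line with direction
   w1 X1 + w2 X2 (second order), then vertically, then in time (first order). *)
Lemma taylor_le f q (e : R) : smooth_on O f -> O q -> hgrad f q = 0 ->
  hhess f q = 0 -> 0 < e -> \forall x \near q,
  f x - f q <= pd_t f q * W4 q x + pd 2%:R f q * W3 q x +
    e * (W1 q x ^+ 2 + W2 q x ^+ 2 + `|W3 q x| + `|W4 q x|).
Proof.
move=> sf Oq g0 h0 e0.
pose S i j x := 'D_(frame i q) ('D_(frame j q) f) x.
pose k (i j : 'I_2) : R :=
  if j == 0 then - coord 1 (frame i q) else coord 0 (frame i q).
have hE i j : S i j q + k i j / 2 * pd 2%:R f q +
    (S j i q + k j i / 2 * pd 2%:R f q) = 0.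
  have /eqP := hhessE f q i j; rewrite h0 mxE eq_sym mulf_eq0 invr_eq0.
  by rewrite pnatr_eq0 orbF !(XX_frame _ _ sf Oq) => /eqP.
have [k00 k11 k01] : [/\ k 0 0 = 0, k 1 1 = 0 & k 0 1 = - k 1 0].
  have [a0 a1 _ _] := frameE q 0; have [b0 b1 _ _] := frameE q 1.
  by split; rewrite /k /= ?a0 ?a1 ?b0 ?b1 /= ?oppr0 ?opprK.
have alg1 (s p : R) : s + 0 / 2 * p + (s + 0 / 2 * p) = 0 -> s = 0 by lra.
have alg2 (s t r p : R) : s + - r / 2 * p + (t + r / 2 * p) = 0 -> t + s = 0 by lra.
have S00 : S 0 0 q = 0 by have := hE 0 0; rewrite k00; exact: alg1.
have S11 : S 1 1 q = 0 by have := hE 1 1; rewrite k11; exact: alg1.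
have S01 : S 1 0 q + S 0 1 q = 0 by have := hE 0 1; rewrite k01; exact: alg2.
have sS i j : smooth_on O (S i j) by apply: smooth_D; exact: smooth_D.
have e20 : 0 < e / 2 by rewrite divr_gt0.
have near0 g : smooth_on O g -> g q = 0 -> \forall x \near q, `|g x| <= e / 2.
  move=> sg gq; have /cvgrPdist_le/(_ _ e20) := smooth_continuous sg Oq.
  by apply: filterS => x; rewrite gq sub0r normrN.
have nearc g : smooth_on O g -> \forall x \near q, `|g x - g q| <= e.
  move=> sg; have /cvgrPdist_le/(_ _ e0) := smooth_continuous sg Oq.
  by apply: filterS => x; rewrite distrC.
have : nbhs q (fun x => [/\ O x, `|pd_t f x - pd_t f q| <= e
    & `|pd 2%:R f x - pd 2%:R f q| <= e] /\
    [/\ `|S 0 0 x| <= e / 2, `|S 1 1 x| <= e / 2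
    & `|S 1 0 x + S 0 1 x| <= e / 2]).
  have n1 := nbhs_open oO Oq.
  have n2 := nearc _ (smooth_D (0, 1) sf).
  have n3 := nearc _ (smooth_D (delta_mx 0 2%:R, 0) sf).
  have n4 := near0 _ (sS 0 0) S00; have n5 := near0 _ (sS 1 1) S11.
  have n6 := near0 _ (smoothD oO (sS 1 0) (sS 0 1)) S01.
  apply: filterS (filterI (filterI n1 (filterI n2 n3))
    (filterI n4 (filterI n5 n6))) => x [[a1 [a2 a3]] [a4 [a5 a6]]].
  exact: (conj (And3 a1 a2 a3) (And3 a4 a5 a6)).
move=> /nbhs_ballP[d /= d0 dO].
pose et : spacetime R := (0, 1); pose e2 : spacetime R := (delta_mx 0 2%:R, 0).
pose m x := `|W1 q x| * `|frame 0 q| + `|W2 q x| * `|frame 1 q| +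
  `|W3 q x| * `|e2| + `|W4 q x| * `|et|.
have [s1 s2 s3 s4] := smooth_W q oO.
have cm : {for q, continuous m}.
  have ca g (r : R) : smooth_on O g -> {for q, continuous (fun x => `|g x| * r)}.
    move=> sg; apply: cvgM; last exact: cvg_cst.
    by apply: cvg_norm; exact: smooth_continuous.
  by apply: cvgD; [apply: cvgD; [apply: cvgD|]|]; exact: ca.
have W0 : [/\ W1 q q = 0, W2 q q = 0, W3 q q = 0 & W4 q q = 0].
  by rewrite /W1 /W2 /W3 /W4; split; field.
have mq : m q = 0.
  by have [w1 w2 w3 w4] := W0; rewrite /m w1 w2 w3 w4 !normr0 !mul0r !addr0.
have nm : \forall x \near q, m x < d.
  have /cvgrPdist_lt/(_ _ d0) := cm; apply: filterS => x.
  by rewrite mq sub0r normrN; apply: le_lt_trans; exact: ler_norm.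
near=> x.
have mx : m x < d by near: x.
set w1 := W1 q x; set w2 := W2 q x; set w3 := W3 q x; set w4 := W4 q x.
pose v := w1 *: frame 0 q + w2 *: frame 1 q.
have xE : x = w4 *: et + (w3 *: e2 + (v + q)) by exact: spacetimeE.
have inb (a b c : R) : 0 <= a <= 1 -> 0 <= b <= 1 -> 0 <= c <= 1 ->
    ball q d (a *: (w4 *: et) + (b *: (w3 *: e2) + (c *: v + q))).
  move=> /andP[a0 a1] /andP[b0 b1] /andP[c0 c1].
  have -> : a *: (w4 *: et) + (b *: (w3 *: e2) + (c *: v + q)) = q +
      (c *: (w1 *: frame 0 q) + c *: (w2 *: frame 1 q) + b *: (w3 *: e2) +
      a *: (w4 *: et)).
    rewrite /v scalerDr [RHS]addrA [RHS]addrC; congr (_ + _).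
    by rewrite [RHS]addrA [RHS]addrC; congr (_ + _); exact: addrC.
  rewrite -ball_normE /= opprD addrA subrr add0r normrN.
  apply: le_lt_trans mx.
  have leaf (r s : R) (z : spacetime R) : 0 <= r -> r <= 1 ->
      `|r *: (s *: z)| <= `|s| * `|z|.
    by move=> r0 r1; rewrite !normrZ (ger0_norm r0) ler_piMl// mulr_ge0.
  do 2 (apply: le_trans (ler_normD _ _) _; apply: lerD; last exact: leaf).
  by apply: le_trans (ler_normD _ _) _; apply: lerD; exact: leaf.
have I0 : 0 <= (0 : R) <= 1 by rewrite lexx ler01.
have I1 : 0 <= (1 : R) <= 1 by rewrite lexx ler01.
have in1 (c : R) : 0 <= c <= 1 -> ball q d (c *: v + q).
  by move=> c01; have := inb _ _ _ I0 I0 c01; rewrite !scale0r !add0r.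
have in2 (c : R) : 0 <= c <= 1 -> ball q d (c *: (w3 *: e2) + (v + q)).
  by move=> c01; have := inb _ _ _ I0 c01 I1; rewrite !scale0r !add0r scale1r.
have in3 (c : R) : 0 <= c <= 1 ->
    ball q d (c *: (w4 *: et) + (w3 *: e2 + (v + q))).
  by move=> c01; have := inb _ _ _ c01 I1 I1; rewrite !scale1r.
have Oin y (b : ball q d y) : O y by have [[Oy _ _] _] := dO _ b; exact: Oy.
have [c4 c401 E4] := MVT_line (fun c c01 => Oin _ (in3 c c01)) sf.
have {E4} L4 : f x - f (w3 *: e2 + (v + q)) <= pd_t f q * w4 + e * `|w4|.
  rewrite {1}xE E4 (deriveZv _ _ sf (Oin _ (in3 _ c401))).
  by apply: mul_near_le; have [[_ h _] _] := dO _ (in3 _ c401); exact: h.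
have [c3 c301 E3] := MVT_line (fun c c01 => Oin _ (in2 c c01)) sf.
have {E3} L3 : f (w3 *: e2 + (v + q)) - f (v + q) <=
    pd 2%:R f q * w3 + e * `|w3|.
  rewrite E3 (deriveZv _ _ sf (Oin _ (in2 _ c301))).
  by apply: mul_near_le; have [[_ _ h] _] := dO _ (in2 _ c301); exact: h.
have [c1 c101 E1] := MVT_line (fun c c01 => Oin _ (in1 c c01)) sf.
have inz (c : R) : 0 <= c <= 1 -> ball q d (c *: (c1 *: v) + q).
  move=> /andP[c0 c1']; rewrite scalerA; apply: in1.
  by case/andP: c101 => ? ?; rewrite mulr_ge0// mulr_ile1.
have [c2 c201 E2] := MVT_line (fun c c01 => Oin _ (inz c c01)) (smooth_D v sf).
have Dv0 : 'D_v f q = 0.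
  rewrite (deriveDv _ _ oO sf Oq) !(deriveZv _ _ sf Oq).
  by rewrite -!(XE _ oO sf Oq) -!hgradE g0 !mxE !mulr0 addr0.
have {E1 E2} L1 : f (v + q) - f q <= e * (w1 ^+ 2 + w2 ^+ 2).
  move: E2; rewrite E1 Dv0 subr0 => ->.
  rewrite (deriveZv _ _ (smooth_D v sf) (Oin _ (inz _ c201))).
  rewrite (horizontal_line q w1 w2 sf (Oin _ (inz _ c201))).
  have [_ [b00 b11 b10]] := dO _ (inz _ c201).
  exact: quadratic_form_le (ltW e0) b00 b11 b10 c101.
have -> : f x - f q = (f x - f (w3 *: e2 + (v + q))) +
  (f (w3 *: e2 + (v + q)) - f (v + q)) + (f (v + q) - f q) by ring.
apply: (le_trans (lerD (lerD L4 L3) L1)).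
move: (pd_t f q) (pd _ f q) => a c.
rewrite le_eqVlt; apply/orP; left; apply/eqP; ring.
Unshelve. all: by end_near. Qed.

End Taylor.

(** * Smooth majorants on the real line *)

Section Flat.
Context {R : realType}.
Implicit Types (p : {poly R}) (x y z : R).

Lemma poly_bound p :
  exists n, exists2 C : R, 0 <= C & forall y, 1 <= y -> `|p.[y]| <= C * y ^+ n.
Proof.
elim/poly_ind: p => [|p c [n [C C0 IH]]].
  by exists 0%N, 0 => // y _; rewrite horner0 normr0 mul0r.
exists n.+1, (C + `|c|) => [|y y1]; first exact: addr_ge0.
rewrite hornerMXaddC (le_trans (ler_normD _ _))// mulrDl lerD//.
  by rewrite normrM (@ger0_norm _ y) ?(le_trans _ y1)// exprSr mulrA
    ler_wpM2r ?IH// (le_trans _ y1).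
by rewrite ler_peMr// exprn_ege1.
Qed.

(* For p = 1 this is the classical flat function exp (-1/x); the family is closed
   under differentiation. *)
Definition flat p x : R := if 0 < x then p.[x^-1] * expR (- x^-1) else 0.

Lemma flat_pos p x : 0 < x -> flat p x = p.[x^-1] * expR (- x^-1).
Proof. by rewrite /flat => ->. Qed.

Lemma flat_npos p x : x <= 0 -> flat p x = 0.
Proof. by rewrite /flat ltNge => ->. Qed.

Definition dflat p : {poly R} := 'X^2 * (p - p^`()).

Lemma is_derive_flat p x : is_derive x 1 (flat p) (flat (dflat p) x).
Proof.
have [x0|x0|->] := ltgtP x 0.
- rewrite flat_npos ?(ltW x0)//.
  apply: (@near_eq_is_derive _ _ _ (cst 0)).
  by apply: filterS (lt_nbhsl x0) => y /ltW y0; rewrite flat_npos.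
- rewrite flat_pos//.
  apply: (@near_eq_is_derive _ _ _ (fun y => p.[y^-1] * expR (- y^-1))).
    by apply: filterS (lt_nbhsr x0) => y /(flat_pos p).
  have xn0 : x != 0 by rewrite gt_eqF.
  have dV : is_derive x 1 (fun y : R => y^-1) (- x ^- 2 *: 1).
    by apply: (@is_deriveV _ id).
  have dN : is_derive x 1 (fun y : R => - y^-1) (- (- x ^- 2 *: 1)).
    exact: is_deriveN.
  have dp : is_derive x 1 (fun y : R => p.[y^-1]) (p^`().[x^-1] * (- x ^- 2 *: 1)).
    exact: (@is_derive1_comp _ (horner p)).
  have de : is_derive x 1 (fun y : R => expR (- y^-1))
      (expR (- x^-1) * (- (- x ^- 2 *: 1))).
    exact: (@is_derive1_comp _ expR).
  refine (is_derive_eq (is_deriveM dp de) _).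
  rewrite /dflat hornerM hornerXn !hornerE /GRing.scale /= -exprVn; ring.
rewrite flat_npos//.
have [n [C C0 pC]] := poly_bound p.
pose N : R := (n.+2)`!%:R.
pose B := C * N.
have bd h : 0 < h -> h <= 1 -> `|flat p h| <= B * h ^+ 2.
  move=> h0 h1; rewrite flat_pos// normrM (ger0_norm (expR_ge0 _)) expRN.
  have hi1 : 1 <= h^-1 by rewrite invf_ge1.
  have hi0 : 0 < h^-1 by rewrite invr_gt0.
  rewrite ler_pdivrMr ?expR_gt0//.
  apply: le_trans (pC _ hi1) _.
  have -> : B * h ^+ 2 * expR h^-1 = C * (h ^+ 2 * (N * expR h^-1)).
    by rewrite /B; ring.
  rewrite ler_wpM2l//.
  have := expR_ge1Dxn n.+1 (ltW hi0).
  move=> /(le_trans (ler_wpDl ler01 (lexx _))).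
  rewrite ler_pdivrMr ?ltr0n ?fact_gt0// => le.
  have hh : h^-1 ^+ 2 * h ^+ 2 = 1 by rewrite -exprMn mulVf ?gt_eqF// expr1n.
  have h20 : 0 < h^-1 ^+ 2 by rewrite exprn_gt0.
  rewrite -(ler_pM2l h20) [leRHS]mulrA hh mul1r -exprD.
  by rewrite [leRHS]mulrC.
have lim0 : h^-1 *: (flat p (h *: 1 + 0) - flat p 0) @[h --> 0^'] --> (0 : R).
  apply/cvgrPdist_le => e e0; near=> h.
  rewrite addr0 [h *: 1]mulr1 (flat_npos _ (lexx 0)) subr0 sub0r normrN.
  have hn0 : h != 0 by near: h; exact: nbhs_dnbhs_neq.
  have h1 : `|h| <= 1 by near: h; exact: dnbhs0_le.
  have h2 : `|h| <= e / (B + 1).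
    by near: h; apply: dnbhs0_le; rewrite divr_gt0// ltr_wpDl// mulr_ge0.
  have B0 : 0 <= B by rewrite mulr_ge0.
  have [hp|hp] := ltP 0 h; last by rewrite flat_npos// scaler0 normr0 ltW.
  rewrite normrZ normfV (gtr0_norm hp) ler_pdivrMl// (le_trans (bd _ hp _))//.
    by rewrite -(gtr0_norm hp).
  rewrite expr2 mulrCA ler_pM2l// -(gtr0_norm hp) (le_trans (ler_wpM2l B0 h2))//.
  rewrite mulrCA ler_piMr// ?(ltW e0)// ler_pdivrMr ?ltr_wpDl// mul1r.
  by rewrite lerDl.
by apply: DeriveDef; [apply/cvg_ex; exists 0|exact: cvg_lim lim0].
Unshelve. all: by end_near. Qed.

Fixpoint flatn (k : nat) : {poly R} := if k is k'.+1 then dflat (flatn k') else 1.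

Lemma flat1_ge x : 1 <= x -> expR (- 1) <= flat 1 x.
Proof.
move=> x1; rewrite flat_pos ?(lt_le_trans ltr01)// hornerE mul1r ler_expR lerN2.
by rewrite invf_le1// (lt_le_trans ltr01).
Qed.

Lemma flat1_ge0 x : 0 <= flat 1 x.
Proof. by rewrite /flat; case: ifP => // _; rewrite hornerE mul1r expR_ge0. Qed.

Lemma smooth_majorant (c : nat -> R) : (forall n, 0 <= c n) ->
  exists G : nat -> R -> R, [/\ forall k x, is_derive x 1 (G k) (G k.+1 x),
    forall x, x <= 0 -> G 0%N x = 0, forall x, 0 <= G 0%N x
    & forall n x, n.+1%:R <= x -> c n <= G 0%N x].
Proof.
move=> c0.
pose S N k x := \sum_(n < N) c n * expR 1 * flat (flatn k) (x - n%:R).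
pose B x := Num.bound x.
have ltB x : 0 <= x -> x < (B x)%:R by exact: archi_boundP.
have Sstab N M k x : x <= N%:R -> (N <= M)%N -> S M k x = S N k x.
  move=> xN NM; rewrite /S -(subnKC NM) big_split_ord /= [X in _ + X]big1 ?addr0//.
  move=> i _; rewrite flat_npos ?mulr0// subr_le0 (le_trans xN)//.
  by rewrite ler_nat leq_addr.
have Seq N M k x : x <= N%:R -> x <= M%:R -> S M k x = S N k x.
  move=> xN xM; have [le|/ltnW le] := leqP N M; first exact: Sstab.
  by rewrite (Sstab _ _ _ _ xM le).
exists (fun k x => S (B `|x|) k x).
have Bge x : x <= (B `|x|)%:R by rewrite (le_trans (ler_norm x))// ltW// ltB.
split.
- move=> k x; pose N := B (`|x| + 1).
  have xN : `|x| + 1 < N%:R by apply: ltB; rewrite addr_ge0.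
  have xleN : x <= N%:R.
    by rewrite (le_trans (ler_norm _))// (le_trans _ (ltW xN))// lerDl.
  rewrite (Seq N _ _ _ xleN (Bge x)).
  apply: (@near_eq_is_derive _ _ _ (S N k)).
    near=> y; apply: Seq; first exact: Bge.
    rewrite ltW// (le_lt_trans _ xN)//.
    have : `|y - x| <= 1.
      rewrite distrC; near: y; apply/nbhs_normP; exists 1 => //= y; exact: ltW.
    by move=> /(le_trans (ler_norm _)) yx; have := ler_norm x; lra.
  have d n : is_derive x 1 (fun y => c n * expR 1 * flat (flatn k) (y - n%:R))
      (c n * expR 1 * flat (flatn k.+1) (x - n%:R)).
    have di : is_derive x 1 (fun y : R => y - n%:R) 1.
      have := is_deriveB (is_derive_id x 1) (is_derive_cst (n%:R : R) x 1).
      by rewrite subr0.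
    have df : is_derive x 1 (fun y => flat (flatn k) (y - n%:R))
        (flat (flatn k.+1) (x - n%:R) * 1).
      exact: (@is_derive1_comp _ _ (fun y => y - n%:R) _ _ _
        (is_derive_flat (flatn k) (x - n%:R)) di).
    by rewrite mulr1 in df; exact: (is_deriveZ (c n * expR 1) df).
  have := @is_derive_sum _ _ _ N
    (fun i y => c i * expR 1 * flat (flatn k) (y - (i : nat)%:R)) x 1 _ (fun i => d i).
  by rewrite fct_sumE.
- by move=> x x0; rewrite (Seq 0%N) ?Bge// /S big_ord0.
- move=> x; apply: sumr_ge0 => i _.
  by rewrite mulr_ge0 ?flat1_ge0// mulr_ge0 ?expR_ge0.
move=> n x nx; have nB : (n < B `|x|%R)%N.
  by rewrite -(ltr_nat R) (lt_le_trans _ (Bge x))// (lt_le_trans _ nx)// ltr_nat.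
rewrite /S (bigD1 (Ordinal nB))//= -[leLHS]addr0 lerD//; last first.
  by apply: sumr_ge0 => i _; rewrite mulr_ge0 ?flat1_ge0// mulr_ge0 ?expR_ge0.
rewrite -mulrA ler_peMr//.
have : expR 1 * expR (- 1) <= expR 1 * flat 1 (x - n%:R).
  by rewrite ler_pM2l ?expR_gt0// flat1_ge// lerBrDl natr1.
by rewrite -expRD subrr expR0.
Unshelve. all: by end_near. Qed.

End Flat.

(** * From local to global maxima *)

Section Localisation.
Context {R : realType}.
Implicit Types (v f : spacetime R -> R) (x y : spacetime R).

Lemma open_open_half : open (@open_half R).
Proof.
have -> : @open_half R = time @^-1` [set r | 0 < r] by [].
by apply: open_comp => [x _|]; [exact: continuous_time|exact: open_gt].
Qed.

Definition sqdist y x : R := W1 y x ^+ 2 + W2 y x ^+ 2 +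
  (coord 2%:R x - coord 2%:R y) ^+ 2 + W4 y x ^+ 2.

Lemma smooth_sqdist O y : open O -> smooth_on O (sqdist y).
Proof.
move=> oO; have [s1 s2 _ s4] := smooth_W y oO.
have s3 : smooth_on O (fun x => coord 2%:R x - coord 2%:R y).
  by apply: smoothB => //; [exact: smooth_coord|exact: smooth_cst].
by apply: smoothD => //; [apply: smoothD => //; [apply: smoothD => //|]|];
  exact: smoothX.
Qed.

Lemma sqdist_self y : sqdist y y = 0.
Proof. by rewrite /sqdist /W1 /W2 /W4 !subrr expr0n /= !addr0. Qed.

Lemma sqdist_le y x (B : R) : sqdist y x <= B ->
  (forall i, (coord i x - coord i y) ^+ 2 <= B) /\ W4 y x ^+ 2 <= B.
Proof.
move=> le; have h1 := sqr_ge0 (W1 y x); have h2 := sqr_ge0 (W2 y x).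
have h4 := sqr_ge0 (W4 y x).
have h3 := sqr_ge0 (coord 2%:R x - coord 2%:R y).
rewrite /sqdist in le; split; last by lra.
move=> -[[|[|[|//]]] i].
- by rewrite (_ : Ordinal i = 0); [rewrite -/(W1 y x); lra|exact: val_inj].
- by rewrite (_ : Ordinal i = 1); [rewrite -/(W2 y x); lra|exact: val_inj].
- by rewrite (_ : Ordinal i = 2%:R); [lra|exact: val_inj].
Qed.

Lemma sqdist_ball y x (r : R) : 0 < r -> sqdist y x < r ^+ 2 -> ball y r x.
Proof.
move=> r0 lt; have [c t] := sqdist_le (lexx (sqdist y x)).
have lt_norm (d : R) : d ^+ 2 <= sqdist y x -> `|d| < r.
  move=> /le_lt_trans/(_ lt); rewrite -real_normK ?num_real//.
  by rewrite ltr_pXn2r ?nnegrE// ltW.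
split; rewrite /ball /=.
  by split=> // i j; rewrite /ball/= distrC (ord1 i); exact: lt_norm (c j).
by rewrite distrC; exact: lt_norm t.
Qed.

Lemma compact_box y (M a b : R) : compact [set x |
  (forall i, `|coord i x - coord i y| <= M) /\ a <= time x <= b].
Proof.
pose A (i : 'I_3) : set R := `[coord i y - M, coord i y + M]%classic.
have cA : compact [set w : 'rV[R]_3 | forall i, A i (w ord0 i)].
  by apply: rV_compact => i; exact: segment_compact.
have := compact_setX cA (@segment_compact R a b).
congr compact; apply/seteqP; split=> [[w t] [/= Aw]|[w t] [/= Aw]].
  rewrite in_itv /= => ?; split=> // i; rewrite /coord /= ler_distl.
  by have := Aw i; rewrite /A /= in_itv.
move=> tab; split; rewrite /= ?in_itv//= => i; rewrite /A /= in_itv /=.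
by have := Aw i; rewrite /coord /= ler_distl.
Qed.

Lemma local_max_globalize v f y :
  (forall x, open_half x -> {for x, continuous v}) ->
  smooth_on open_half f -> open_half y ->
  (\forall x \near y, v x - f x <= v y - f y) ->
  exists g, [/\ smooth_on open_half g, \forall x \near y, f x = g x
    & forall x, open_half x -> v x - g x <= v y - g y].
Proof.
move=> cv sf Oy /nbhs_ballP[r /= r0 hr].
have oO := open_open_half.
(* A smooth exhaustion of the half-space: its sublevel sets are compact, and
   after scaling by K the sublevel set of height 2 lies in the ball where y is
   maximal. *)
pose rho x := sqdist y x + W4 y x ^+ 2 * (time x)^-1.
have [_ _ _ s4] := smooth_W y oO.
have srho : smooth_on open_half rho.
  apply: smoothD => //; first exact: smooth_sqdist.
  apply: smoothM => //; first exact: smoothX.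
  by apply: smoothV => [//|x|]; [rewrite /open_half /= => /gt_eqF ->|exact: smooth_time].
have rho_y : rho y = 0.
  by rewrite /rho sqdist_self /W4 subrr expr0n /= mul0r addr0.
have rho_ge x : open_half x -> sqdist y x <= rho x.
  rewrite /open_half /= => x0; rewrite /rho lerDl mulr_ge0 ?sqr_ge0//.
  by rewrite invr_ge0 ltW.
pose K := 4 / r ^+ 2.
have K0 : 0 < K by rewrite divr_gt0 ?exprn_gt0.
pose box (B : R) := [set x | (forall i, `|coord i x - coord i y| <= B + 1) /\
  time y ^+ 2 / (2 * time y + B) <= time x <= time y + B + 1].
have rho_box B x : open_half x -> rho x <= B -> box B x.
  rewrite /open_half /= => x0 rB.
  have [cB tB] := sqdist_le (le_trans (rho_ge _ x0) rB).
  have B0 : 0 <= B := le_trans (sqr_ge0 _) tB.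
  have le1 (d : R) : d ^+ 2 <= B -> `|d| <= B + 1.
    move=> dB; rewrite ler_norml; apply/andP; split; nra.
  split=> [i|]; first exact: le1.
  apply/andP; split.
    rewrite ler_pdivrMr; last by rewrite ltr_wpDr// mulr_gt0.
    have : W4 y x ^+ 2 <= B * time x.
      rewrite -ler_pdivrMr//; apply: le_trans rB; rewrite /rho lerDr.
      have h1 := sqr_ge0 (W1 y x); have h2 := sqr_ge0 (W2 y x).
      have h3 := sqr_ge0 (coord 2%:R x - coord 2%:R y).
      by rewrite /sqdist !addr_ge0 ?sqr_ge0.
    rewrite /W4; move: (time x) (time y) => t s; have := sqr_ge0 t; nra.
  have := le1 _ tB; rewrite /W4 ler_norml => /andP[_]; lra.
have bound (n : nat) : exists C : R, 0 <= C /\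
    forall x, open_half x -> rho x <= n.+3%:R / K ->
      (v x - f x) - (v y - f y) <= C.
  pose B := n.+3%:R / K.
  have B0 : 0 <= B by rewrite divr_ge0// ltW.
  have boxO x : box B x -> open_half x.
    move=> [_ /andP[+ _]]; apply: lt_le_trans.
    by rewrite divr_gt0 ?exprn_gt0 ?ltr_wpDr ?mulr_gt0.
  have ybox : box B y by apply: rho_box => //; rewrite rho_y.
  have [||c cb cmax] := @compact_EVT_max _ R (fun x => v x - f x) (box B) _
    (@compact_box _ _ _ _).
  - by exists y.
  - apply: continuous_in_subspaceT => x; rewrite inE => /boxO Ox.
    by apply: cvgB; [exact: cv|exact: smooth_continuous sf Ox].
  exists (v c - f c - (v y - f y)); split.
    by rewrite subr_ge0 cmax// inE.
  by move=> x Ox xB; rewrite lerD2r cmax// inE; exact: rho_box.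
have [C /all_and2[C0 Cbd]] := choice bound.
have [G [dG G0 Gge0 Gmaj]] := smooth_majorant C0.
have sg : smooth_on open_half (fun x => f x + G 0%N (K * rho x - 1)).
  apply: smoothD => //; apply: smooth_comp1 => //.
  by apply: smoothB => //; [exact: smoothZ|exact: smooth_cst].
exists (fun x => f x + G 0%N (K * rho x - 1)); split=> //.
  have : K * rho x - 1 @[x --> y] --> (-1 : R).
    rewrite -[X in _ --> X]add0r -[X in _ --> X + _](mulr0 K) -rho_y.
    apply: cvgB; last exact: cvg_cst.
    by apply: cvgM; [exact: cvg_cst|exact: smooth_continuous srho Oy].
  move=> /cvgr_lt/(_ 0); rewrite ltrN10 => /(_ isT).
  by apply: filterS => x /ltW/G0 ->; rewrite addr0.
move=> x Ox; rewrite rho_y mulr0 sub0r (G0 (-1)) ?lerN10// addr0 opprD addrA.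
have [z1|z1] := leP (K * rho x - 1) 1.
  have /hr : ball y r x.
    apply: sqdist_ball => //; apply: le_lt_trans (rho_ge _ Ox) _.
    have : K * rho x <= 2 by lra.
    rewrite mulrC -ler_pdivlMr// => /le_lt_trans; apply.
    rewrite /K invf_div mulrA ltr_pdivrMr//.
    have : 0 < r ^+ 2 by rewrite exprn_gt0.
    lra.
  by apply: le_trans; rewrite lerBlDr lerDl.
set z := K * rho x - 1.
have [n /andP[nz zn]] : exists n : nat, n.+1%:R <= z < n.+2%:R.
  have := truncn_itv (ltW (lt_trans ltr01 z1)); rewrite -/z.
  case: (Num.truncn z) => [|n] /andP[h1 h2]; last by exists n; rewrite h1.
  by have := lt_trans z1 h2; rewrite ltxx.
have := Cbd n x Ox; have := Gmaj _ _ nz.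
have : rho x <= n.+3%:R / K.
  by rewrite ler_pdivlMr// mulrC -(natr1 n.+2) -lerBlDr ltW.
move=> h1 h2 /(_ h1); lra.
Qed.

Lemma subsolution_local_max v f y : subsolution open_half (EFin \o v) ->
  (forall x, open_half x -> {for x, continuous v}) ->
  smooth_on open_half f -> open_half y ->
  (\forall x \near y, v x - f x <= v y - f y) ->
  (hgrad f y != 0 -> pd_t f y + F (hgrad f y) (hhess f y) <= 0)
  /\ (hgrad f y = 0 -> hhess f y = 0 -> pd_t f y <= 0).
Proof.
move=> [_ _ sub] cv sf Oy loc.
have [g [sg fg gmax]] := local_max_globalize cv sf Oy loc.
have [-> -> ->] := jet_near_eq fg.
by apply: sub => //; split=> // x Ox; exact: gmax.
Qed.

End Localisation.

(** * Semicontinuity and contact points *)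

Section Semicontinuity.
Context {R : realType}.
Context (O : set (spacetime R)) (oO : open O).
Implicit Types (f : spacetime R -> R).

Lemma continuous_lsc f :
  (forall x, O x -> {for x, continuous f}) -> lsc_on O (EFin \o f).
Proof.
move=> cf x a /=; rewrite lte_fin => ax.
have [Ox|nOx] := pselect (O x).
  exists (fun y => a < f y); last by move=> y; rewrite lte_fin.
  rewrite -nbhs_subspace_interior; last exact: open_nbhs_nbhs (conj oO Ox).
  by move/cvgr_gt: (cf _ Ox) => /(_ _ ax).
exists [set x]; last by move=> y ->; rewrite lte_fin.
by case: (@nbhs_subspaceP _ O x) => [/nOx //|_ y].
Qed.

Lemma lsc_near f x (a : R) : lsc_on O (EFin \o f) -> O x -> a < f x ->
  \forall y \near x, a < f y.
Proof.
move=> lf Ox ax; have [V Vx Vf] := lf x a (ax : (a%:E < (f x)%:E)%E).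
rewrite -nbhs_subspace_interior in Vx; last exact: open_nbhs_nbhs (conj oO Ox).
by apply: filterS Vx => y /Vf /=; rewrite lte_fin.
Qed.

Lemma semicontinuous_continuous f : usc_on O (EFin \o f) ->
  lsc_on O (EFin \o f) -> forall x, O x -> {for x, continuous f}.
Proof.
move=> uf lf x Ox; apply/cvgrPdist_lt => e e0.
have f1 : f x - e < f x by rewrite ltrBlDr ltrDl.
have f2 : - f x - e < - f x by rewrite ltrBlDr ltrDl.
have n1 := lsc_near lf Ox f1; have n2 := @lsc_near (- f) _ _ uf Ox f2.
apply: filterS (filterI n1 n2) => y [/= h1 h2]; rewrite ltr_distl.
have {}h2 : - f x - e < - f y := h2.
by apply/andP; split; lra.
Qed.

End Semicontinuity.

Section Stability.
Context {R : realType}.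
Implicit Types (ueps : R -> spacetime R -> R) (u f : spacetime R -> R).
Implicit Types (x y q : spacetime R).

Lemma loc_unif_near ueps u q : cvg_loc_unif closed_half ueps u ->
  open_half q -> exists2 U, nbhs q U & forall e : R, 0 < e ->
    exists2 eps : R, 0 < eps & forall y, U y -> `|u y - ueps eps y| < e.
Proof.
move=> cvg Oq; have cq : closed_half q by exact: ltW.
have [U Uq Ucvg] := cvg q cq; exists (U `&` open_half).
  by apply: filterI => //; exact: open_nbhs_nbhs (conj open_open_half Oq).
move=> e e0.
have : nbhs (u : {uniform` U `&` closed_half -> R})
    [set h | forall y, (U `&` closed_half) y -> `|u y - h y| < e].
  apply/uniform_nbhs; exists [set xy | `|xy.1 - xy.2| < e]; split=> //.
  rewrite -entourage_ballE; exists e => //=.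
move=> /Ucvg /= near_u.
have : \forall eps \near (0 : R)^'+, 0 < eps /\
    forall y, (U `&` closed_half) y -> `|u y - ueps eps y| < e.
  by apply: filterI; [exact: nbhs_right_gt|exact: near_u].
move=> /filter_ex[eps [eps0 h]]; exists eps => // y [Uy Oy].
by apply: h; split=> //; exact: ltW.
Qed.

Lemma loc_unif_continuous ueps u q : cvg_loc_unif closed_half ueps u ->
  (forall eps, 0 < eps -> forall x, open_half x ->
    {for x, continuous (ueps eps)}) ->
  open_half q -> {for q, continuous u}.
Proof.
move=> cvg cu Oq; have [U Uq Ucvg] := loc_unif_near cvg Oq.
apply/cvgrPdist_lt => e e0; have e3 : 0 < e / 3 by rewrite divr_gt0.
have [eps eps0 h] := Ucvg _ e3.
have /cvgrPdist_lt/(_ _ e3) n1 := cu _ eps0 _ Oq.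
apply: filterS (filterI Uq n1) => y [/h h1 h2].
have h3 := h _ (nbhs_singleton Uq).
move: h1 h2 h3; rewrite !ltr_norml => /andP[? ?] /andP[? ?] /andP[? ?].
by apply/andP; split; lra.
Qed.

Definition box q (M : R) : set (spacetime R) := [set x |
  (forall i, `|coord i x - coord i q| <= M) /\
  time q - M <= time x <= time q + M].

Lemma sqdist_box q x (M : R) : 0 < M -> sqdist q x < M ^+ 2 -> box q M x.
Proof.
move=> M0 /(sqdist_ball M0) [[_ c] t]; split.
  by move=> i; have := c ord0 i; rewrite /ball /= distrC => /ltW.
by rewrite -ler_distl distrC; exact: ltW.
Qed.

Lemma box_nbhs q (N : set (spacetime R)) : nbhs q N ->
  exists2 M : R, 0 < M & box q M `<=` N.
Proof.
move=> /nbhs_ballP[r /= r0 rN]; exists (r / 2); first by rewrite divr_gt0.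
move=> x [c t]; apply: rN.
have lt (a : R) : a <= r / 2 -> a < r by move=> /le_lt_trans; apply; lra.
split; rewrite /ball /=.
  by split=> // i j; rewrite /ball/= distrC (ord1 i); exact: lt (c j).
by rewrite distrC; apply: lt; rewrite ler_distl.
Qed.

Lemma contact_point ueps u f q (M eta : R) :
  (forall e : R, 0 < e -> exists2 eps : R, 0 < eps &
    forall y, box q M y -> `|u y - ueps eps y| < e) ->
  (forall eps, 0 < eps -> forall x, open_half x ->
    {for x, continuous (ueps eps)}) ->
  smooth_on open_half f -> 0 < M -> 0 < eta -> box q M `<=` open_half ->
  (forall x, box q M x -> u q - f q - eta <= u x - f x ->
    sqdist q x < M ^+ 2) ->
  exists eps y, [/\ 0 < eps, box q M y, u q - f q - eta <= u y - f y
    & \forall x \near y, ueps eps x - f x <= ueps eps y - f y].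
Proof.
move=> cvg cu sf M0 eta0 bO sq.
have [|eps eps0 h] := cvg (eta / 2); first by rewrite divr_gt0.
have bq : box q M q.
  by apply: sqdist_box => //; rewrite sqdist_self exprn_gt0.
have [||y /set_mem by_ ymax] := @compact_EVT_max _ R
  (fun x => ueps eps x - f x) (box q M) _ (@compact_box _ _ _ _ _).
- by exists q.
- apply: continuous_in_subspaceT => x; rewrite inE => /bO Ox.
  by apply: cvgB; [exact: cu|exact: smooth_continuous sf Ox].
have yq : u q - f q - eta <= u y - f y.
  have := ymax _ (mem_set bq); have := h _ bq; have := h _ by_.
  rewrite !ltr_norml => /andP[? ?] /andP[? ?]; lra.
exists eps, y; split=> //.
have : \forall x \near y, sqdist q x < M ^+ 2.
  have := smooth_continuous (smooth_sqdist q openT) (I : setT y).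
  by move=> /cvgr_lt; apply; exact: sq.
by apply: filterS => x /(sqdist_box M0) bx; apply: ymax; exact: mem_set.
Qed.

End Stability.

(** * Passage to the limit *)

Section Limit.
Context {R : realType}.
Implicit Types (ueps : R -> spacetime R -> R) (u f g : spacetime R -> R).
Implicit Types (x y q : spacetime R).

Lemma X_M O i f g x : open O -> smooth_on O f -> smooth_on O g -> O x ->
  X i (fun y => f y * g y) x = f x * X i g x + g x * X i f x.
Proof.
move=> oO sf sg Ox; apply: (X_val oO _ Ox); first exact: smoothM.
rewrite !(XE i oO _ Ox)//; apply: is_derive_lamM; exact: smooth_is_derive.
Qed.

Lemma is_derive_sqdist q v : is_derive q v (sqdist q) 0.
Proof.
have sq f (d : R) : is_derive q v f d -> f q = 0 ->
    is_derive q v (fun x => f x ^+ 2) 0.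
  by move=> df f0; have := is_derive_lamX 2 df; rewrite f0 mulr0 mul0r.
have w3 := is_derive_lamD (is_derive_coord 2%:R v q)
  (is_derive_lamC q v (- coord 2%:R q)).
have D := is_derive_lamD (is_derive_lamD (is_derive_lamD
  (sq _ _ (is_derive_W1 q q v) (subrr _)) (sq _ _ (is_derive_W2 q q v) (subrr _)))
  (sq _ _ w3 (subrr _))) (sq _ _ (is_derive_W4 q q v) (subrr _)).
by rewrite !addr0 in D.
Qed.

Lemma jet_sqdist2 q (s := fun x => sqdist q x * sqdist q x) :
  [/\ hgrad s q = 0, hhess s q = 0 & pd_t s q = 0].
Proof.
have sm : smooth_on setT (sqdist q) := smooth_sqdist q openT.
have Xs i : X i (sqdist q) q = 0.
  exact: (X_val openT sm (I : setT q) (is_derive_sqdist q _)).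
have XXs i j : X i (X j s) q = 0.
  have -> : X j s = fun x => sqdist q x * X j (sqdist q) x +
      sqdist q x * X j (sqdist q) x.
    by apply/funext => x; rewrite /s (X_M j openT sm sm (I : setT x)).
  have smX : smooth_on setT (X j (sqdist q)) := smooth_X j openT sm.
  have smM := smoothM openT sm smX.
  rewrite (X_D i openT smM smM (I : setT q)) (X_M i openT sm smX (I : setT q)).
  by rewrite !Xs sqdist_self !(mul0r, mulr0, addr0).
split.
- apply/rowP => i; rewrite hgradE mxE /s (X_M i openT sm sm (I : setT q)).
  by rewrite sqdist_self !mul0r addr0.
- by apply/matrixP => i j; rewrite hhessE !XXs addr0 mul0r mxE.
- apply: (@derive_val _ _ _ q (0, 1)).
  have := is_derive_lamM (is_derive_sqdist q (0, 1)) (is_derive_sqdist q (0, 1)).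
  by rewrite !mulr0 addr0.
Qed.

Lemma curvature_continuous O f q : open O -> smooth_on O f -> O q ->
  hgrad f q != 0 ->
  {for q, continuous (fun x => pd_t f x + F (hgrad f x) (hhess f x))} /\
  \forall x \near q, hgrad f x != 0.
Proof.
move=> oO sf Oq g0.
have cX i : {for q, continuous (X i f)}.
  by apply: smooth_continuous Oq; exact: smooth_X.
have cXX i j : {for q, continuous (X i (X j f))}.
  by apply: smooth_continuous Oq; do 2 apply: smooth_X => //.
pose n x := X 0 f x ^+ 2 + X 1 f x ^+ 2.
have c2 i : {for q, continuous (fun x => X i f x ^+ 2)}.
  by apply: cvgM; exact: cX.
have cn : {for q, continuous n} by apply: cvgD; exact: c2.
have n0 x : (n x == 0) = (hgrad f x == 0).
  rewrite /n paddr_eq0 ?sqr_ge0// !sqrf_eq0; apply/idP/eqP.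
    move=> /andP[/eqP a0 /eqP a1]; apply/rowP => i; rewrite hgradE mxE.
    by elim/ord2_ind: i.
  by move=> g; rewrite -!hgradE g !mxE eqxx.
have nq : 0 < n q by rewrite lt_neqAle eq_sym n0 g0 addr_ge0 ?sqr_ge0.
split; last first.
  move/cvgr_gt: cn => /(_ _ nq); apply: filterS => x nx.
  by rewrite -n0 gt_eqF.
have ch i j : {for q, continuous (fun x => (X i (X j f) x + X j (X i f) x) / 2)}.
  apply: cvgM; last exact: cvg_cst.
  by apply: cvgD; exact: cXX.
have -> : (fun x => pd_t f x + F (hgrad f x) (hhess f x)) = fun x =>
    pd_t f x + ((n x)^-1 * (X 0 f x ^+ 2 * ((X 0 (X 0 f) x + X 0 (X 0 f) x) / 2) +
      X 0 f x * X 1 f x * ((X 0 (X 1 f) x + X 1 (X 0 f) x) / 2 +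
        (X 1 (X 0 f) x + X 0 (X 1 f) x) / 2) +
      X 1 f x ^+ 2 * ((X 1 (X 1 f) x + X 1 (X 1 f) x) / 2)) -
    ((X 0 (X 0 f) x + X 0 (X 0 f) x) / 2 + (X 1 (X 1 f) x + X 1 (X 1 f) x) / 2)).
  by apply/funext => x; rewrite FE !hgradE !hhessE.
apply: cvgD; first by apply: smooth_continuous Oq; exact: smooth_D.
apply: cvgB; last by apply: cvgD; exact: ch.
apply: cvgM; first by apply: cvgV; [rewrite gt_eqF|exact: cn].
apply: cvgD; last by apply: cvgM; [exact: c2|exact: ch].
apply: cvgD; first by apply: cvgM; [exact: c2|exact: ch].
by apply: cvgM; [apply: cvgM; exact: cX|apply: cvgD; exact: ch].
Qed.

Lemma near_max_lt (a d e M : R) : 0 <= a -> 0 < M -> d <= e ->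
  e - M ^+ 4 / 2 <= d - a * a -> a < M ^+ 2.
Proof.
move=> a0 M0 de h; rewrite ltNge; apply/negP => le.
have M4 : 0 < M ^+ 4 by rewrite exprn_gt0.
have : M ^+ 2 * M ^+ 2 <= a * a by rewrite ler_pM// exprn_ge0// ltW.
by rewrite -exprD; lra.
Qed.

Lemma penalised_le (A s r b c : R) : 0 < s -> 0 < A -> 0 <= r -> 0 <= b ->
  0 <= c -> A * (r ^+ 2 + b ^+ 2 + c ^+ 2) <= s * (r + b + c) + s ^+ 2 / A ->
  r + b + c <= 4 * s / A.
Proof.
move=> s0 A0 r0 b0 c0 h; rewrite ler_pdivlMr// mulrC leNgt; apply/negP => lt.
have : A * (A * (r ^+ 2 + b ^+ 2 + c ^+ 2)) <= s * (A * (r + b + c)) + s ^+ 2.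
  have -> : s * (A * (r + b + c)) + s ^+ 2 =
      A * (s * (r + b + c) + s ^+ 2 / A) by field; rewrite gt_eqF.
  by rewrite ler_pM2l.
have : (A * (r + b + c)) ^+ 2 <= 3 * (A * (A * (r ^+ 2 + b ^+ 2 + c ^+ 2))).
  have : 0 <= A ^+ 2 * ((r - b) ^+ 2 + (b - c) ^+ 2 + (r - c) ^+ 2).
    by rewrite mulr_ge0 ?addr_ge0 ?sqr_ge0.
  lra.
move: (A * (A * _)) (A * (r + b + c)) lt => z w lt h1 h2.
have : 0 < (w - 4 * s) * (w + s) by rewrite mulr_gt0 ?subr_gt0//; lra.
have : 0 < s * s by rewrite mulr_gt0.
lra.
Qed.

Lemma sqdist_le_gauge q x :
  W1 q x ^+ 2 + W2 q x ^+ 2 + `|W3 q x| + `|W4 q x| <= 1 ->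
  sqdist q x <= (4 + (coord 0 q ^+ 2 + coord 1 q ^+ 2) / 2) *
    (W1 q x ^+ 2 + W2 q x ^+ 2 + `|W3 q x| + `|W4 q x|).
Proof.
rewrite /sqdist.
have -> : coord 2%:R x - coord 2%:R q =
    W3 q x + (coord 0 q * W2 q x - coord 1 q * W1 q x) / 2.
  by rewrite /W3 /W2 /W1; field.
rewrite -[W4 q x ^+ 2]real_normK ?num_real//.
have : W3 q x ^+ 2 = `|W3 q x| ^+ 2 by rewrite real_normK ?num_real.
have := normr_ge0 (W3 q x); have := normr_ge0 (W4 q x).
move: (W3 q x) (W4 q x) (W1 q x) (W2 q x) (coord 0 q) (coord 1 q).
move=> w z r t a b z0 w0 wE S1.
have r2 := sqr_ge0 r; have t2 := sqr_ge0 t.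
have w1 : `|w| ^+ 2 <= `|w| by rewrite expr2 ler_piMr//; lra.
have z1 : `|z| ^+ 2 <= `|z| by rewrite expr2 ler_piMr//; lra.
have p1 := sqr_ge0 (w - (a * t - b * r) / 2).
have p2 := sqr_ge0 (a * r + b * t).
have p3 : 0 <= (a ^+ 2 + b ^+ 2) * (`|w| + `|z|).
  by rewrite mulr_ge0 ?addr_ge0 ?sqr_ge0.
lra.
Qed.

Lemma le0_scale (C a : R) : 0 < C ->
  (forall s : R, 0 < s -> a <= C * s) -> a <= 0.
Proof.
move=> C0 H; rewrite leNgt; apply/negP => a0.
have := H (a / (2 * C)); rewrite divr_gt0 ?mulr_gt0// => /(_ isT).
have -> : C * (a / (2 * C)) = a / 2 by field; rewrite gt_eqF.
lra.
Qed.

Lemma gauge_self q (a c A : R) : gauge q a c A q = 0.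
Proof. by rewrite /gauge /W1 /W2 /W3 /W4; field. Qed.

Context (ueps : R -> spacetime R -> R) (u : spacetime R -> R)
  (cvg : cvg_loc_unif closed_half ueps u)
  (cont : forall eps, 0 < eps -> forall x, open_half x ->
    {for x, continuous (ueps eps)})
  (sub : forall eps, 0 < eps -> subsolution open_half (EFin \o ueps eps)).

Lemma limit_regular f q : smooth_on open_half f -> open_half q ->
  (forall x, open_half x -> u x - f x <= u q - f q) -> hgrad f q != 0 ->
  pd_t f q + F (hgrad f q) (hhess f q) <= 0.
Proof.
move=> sf Oq fmax gn0; rewrite leNgt; apply/negP => pos.
have oO : open (@open_half R) := open_open_half.
pose s x := sqdist q x * sqdist q x; pose p x := f x + s x.
have ss : smooth_on open_half s.
  by apply: smoothM => //; exact: smooth_sqdist.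
have sp : smooth_on open_half p by exact: smoothD.
have [jg jh jt] := jet_D oO sf ss Oq; have [sg sh st] := jet_sqdist2 q.
rewrite -/s in sg sh st.
rewrite sg sh st !addr0 in jg jh jt.
have pq0 : hgrad p q != 0 by rewrite jg.
have [cL nL] := curvature_continuous oO sp Oq pq0.
have nL' : \forall x \near q, 0 < pd_t p x + F (hgrad p x) (hhess p x).
  by move/cvgr_gt: cL; apply; rewrite jg jh jt.
have [U Uq Ucvg] := loc_unif_near cvg Oq.
have [M M0 bN] := box_nbhs (filterI (filterI Uq (open_nbhs_nbhs (conj oO Oq)))
  (filterI nL nL')).
have sq x : box q M x -> u q - p q - M ^+ 4 / 2 <= u x - p x ->
    sqdist q x < M ^+ 2.
  move=> /bN[[_ /fmax h] _] h2.
  have s0 : 0 <= sqdist q x by rewrite !addr_ge0 ?sqr_ge0.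
  apply: (near_max_lt s0 M0 h).
  by move: h2; rewrite /p /s sqdist_self mul0r addr0 opprD addrA.
have near_u (e : R) : 0 < e -> exists2 eps : R, 0 < eps &
    forall y, box q M y -> `|u y - ueps eps y| < e.
  move=> /Ucvg[eps eps0 h]; exists eps => // y /bN[[Uy _] _]; exact: h.
have eta0 : 0 < M ^+ 4 / 2 by rewrite divr_gt0 ?exprn_gt0.
have bO : box q M `<=` open_half by move=> x /bN[[_ Ox] _].
have [eps [y [eps0 /bN[[_ Oy] [gy Ly]] _ loc]]] :=
  contact_point near_u cont sp M0 eta0 bO sq.
have [+ _] := subsolution_local_max (sub eps0) (cont eps0) sp Oy loc.
by move=> /(_ gy); rewrite leNgt Ly.
Qed.

Lemma limit_singular f q : smooth_on open_half f -> open_half q ->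
  (forall x, open_half x -> u x - f x <= u q - f q) ->
  hgrad f q = 0 -> hhess f q = 0 -> pd_t f q <= 0.
Proof.
move=> sf Oq fmax g0 h0.
apply: (@le0_scale 312); first by rewrite ltr0n.
move=> s s0; have oO : open (@open_half R) := open_open_half.
have tay := taylor_le oO sf Oq g0 h0 s0.
move: (pd_t f q) (pd _ f q) tay => a c tay.
have [U Uq Ucvg] := loc_unif_near cvg Oq.
have [M M0 bN] := box_nbhs (filterI (filterI Uq (open_nbhs_nbhs (conj oO Oq))) tay).
pose k : R := 4 + (coord 0 q ^+ 2 + coord 1 q ^+ 2) / 2.
have k0 : 0 < k by rewrite ltr_wpDr// divr_ge0// addr_ge0 ?sqr_ge0.
have M2 : 0 < M ^+ 2 by rewrite exprn_gt0.
pose B := 2 * k / M ^+ 2 + 1.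
have B1 : 1 <= B by rewrite lerDr divr_ge0// ?mulr_ge0// ltW.
have B0 : 0 < B := lt_le_trans ltr01 B1.
pose A := 4 * s * B.
have A0 : 0 < A by rewrite !mulr_gt0.
have sA : 4 * s / A = B^-1.
  by rewrite /A invfM mulrA divff ?mul1r// gt_eqF// mulr_gt0.
have small x : box q M x ->
    u q - gauge q a c A q - s ^+ 2 / A <= u x - gauge q a c A x ->
    W1 q x ^+ 2 + W2 q x ^+ 2 + `|W3 q x| + `|W4 q x| <= B^-1.
  move=> /bN[[_ /fmax h1] h2]; rewrite gauge_self => h3.
  rewrite -sA; apply: penalised_le => //; first by rewrite addr_ge0 ?sqr_ge0.
  rewrite !real_normK ?num_real//; move: h1 h2 h3; rewrite /gauge; lra.
have sq x : box q M x ->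
    u q - gauge q a c A q - s ^+ 2 / A <= u x - gauge q a c A x ->
    sqdist q x < M ^+ 2.
  move=> bx mx; have S := small x bx mx.
  have S1 : B^-1 <= 1 by rewrite invf_le1.
  apply: le_lt_trans (sqdist_le_gauge (le_trans S S1)) _; rewrite -/k.
  apply: le_lt_trans (_ : k / B < _); first by rewrite ler_pM2l.
  rewrite ltr_pdivrMr// /B mulrDr mulr1 [M ^+ 2 * _]mulrC divfK ?gt_eqF//; lra.
have near_u (e : R) : 0 < e -> exists2 eps : R, 0 < eps &
    forall y, box q M y -> `|u y - ueps eps y| < e.
  move=> /Ucvg[eps eps0 h]; exists eps => // y /bN[[Uy _] _]; exact: h.
have eta0 : 0 < s ^+ 2 / A by rewrite divr_gt0 ?exprn_gt0.
have bO : box q M `<=` open_half by move=> x /bN[[_ Ox] _].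
have sg : smooth_on open_half (gauge q a c A) by exact: smooth_gauge.
have [eps [y [eps0 by_ ymax loc]]] :=
  contact_point near_u cont sg M0 eta0 bO sq.
have [gn gz] := subsolution_local_max (sub eps0) (cont eps0) sg (bO _ by_) loc.
apply: le_trans (gauge_test A0 gn gz) _.
have := small y by_ ymax; rewrite -sA ler_pdivlMr//.
have p1 : 0 <= A * `|W3 q y| by rewrite mulr_ge0// ltW.
have p2 : 0 <= A * `|W4 q y| by rewrite mulr_ge0// ltW.
have p3 : 0 <= A * W1 q y ^+ 2 by rewrite mulr_ge0 ?sqr_ge0// ltW.
have p4 : 0 <= A * W2 q y ^+ 2 by rewrite mulr_ge0 ?sqr_ge0// ltW.
lra.
Qed.

Lemma limit_subsolution : subsolution open_half (EFin \o u).
Proof.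
split=> [|x _|f q sf [Oq _ fmax]]; last 1 first.
- have fmax' x : open_half x -> u x - f x <= u q - f q.
    by move=> /fmax; rewrite /= -!EFinB lee_fin.
  by split; [exact: limit_regular|exact: limit_singular].
- apply: (@continuous_lsc _ _ open_open_half (fun x => - u x)) => x Ox.
  by apply: cvgN; exact: loc_unif_continuous cvg cont Ox.
- by rewrite /= ltry.
Qed.

End Limit.

Section Duality.
Context {R : realType}.
Implicit Types (u f : spacetime R -> R).

Lemma supersolutionN u : supersolution open_half (EFin \o u) ->
  subsolution open_half (EFin \o (fun x => - u x)).
Proof.
have oO : open (@open_half R) := open_open_half.
move=> [lu _ super]; split=> [|x _|f q sf [Oq _ fmax]].
- move: lu; rewrite /usc_on; congr lsc_on; apply/funext => x /=.
  by rewrite opprK.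
- by rewrite /= ltry.
- have [jg jh jt] := jet_N oO sf Oq.
  have [|h1 h2] := super (fun x => - f x) q (smoothN oO sf).
    split=> // x /fmax; rewrite /= -!EFinB !lee_fin; lra.
  rewrite jg jh jt in h1 h2; split=> [g0|g0 h0].
    by have := h1; rewrite oppr_eq0 F_opp -opprD oppr_ge0; exact.
  by have := h2; rewrite g0 h0 !oppr0 oppr_ge0; exact.
Qed.

Lemma subsolutionN u : subsolution open_half (EFin \o (fun x => - u x)) ->
  supersolution open_half (EFin \o u).
Proof.
have oO : open (@open_half R) := open_open_half.
move=> [lu _ super]; split=> [|x _|f q sf [Oq _ fmin]].
- move: lu; rewrite /usc_on; congr lsc_on; apply/funext => x /=.
  by rewrite opprK.
- by rewrite /= ltNyr.
- have [jg jh jt] := jet_N oO sf Oq.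
  have [|h1 h2] := super (fun x => - f x) q (smoothN oO sf).
    split=> // x /fmin; rewrite /= -!EFinB !lee_fin; lra.
  rewrite jg jh jt in h1 h2; split=> [g0|g0 h0].
    by have := h1; rewrite oppr_eq0 F_opp -opprD oppr_le0; exact.
  by have := h2; rewrite g0 h0 !oppr0 oppr_le0; exact.
Qed.

Lemma cvg_loc_unifN (D : set (spacetime R)) ueps u : cvg_loc_unif D ueps u ->
  cvg_loc_unif D (fun eps x => - ueps eps x) (fun x => - u x).
Proof.
move=> cvg x Dx; have [U Ux Ucvg] := cvg x Dx; exists U => //.
move=> P /uniform_nbhs[E [entE EP]].
have : nbhs (u : {uniform` U `&` D -> R})
    [set h | forall y, (U `&` D) y -> E (- u y, - h y)].
  apply/uniform_nbhs; exists [set z | E (- z.1, - z.2)]; split=> //.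
  move: entE; rewrite -!entourage_ballE => -[e /= e0 eE]; exists e => //= z ze.
  by apply: eE; move: ze; rewrite /= /ball /= -opprD normrN.
move=> /Ucvg /= near_u.
have {near_u} near_u : \forall eps \near (0 : R)^'+,
    forall y, (U `&` D) y -> E (- u y, - ueps eps y) by exact: near_u.
change (\forall eps \near (0 : R)^'+, P (fun x => - ueps eps x)).
by apply: filterS near_u => eps h; exact: EP.
Qed.

End Duality.

Theorem theorem6p1 (R : realType) (ueps : R -> spacetime R -> R)
    (u : spacetime R -> R)
    (hsol : forall eps : R, 0 < eps ->
       solution open_half (fun x => (ueps eps x)%:E))
    (hcvg : cvg_loc_unif closed_half ueps u) :
  solution open_half (fun x => (u x)%:E).
Proof.
have cont eps : 0 < eps -> forall x, open_half x ->
    {for x, continuous (ueps eps)}.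
  move=> /hsol[[usc _ _] [lsc _ _]].
  exact: (semicontinuous_continuous open_open_half usc lsc).
split; first by apply: limit_subsolution hcvg cont _ => eps /hsol[].
apply: subsolutionN; apply: limit_subsolution (cvg_loc_unifN hcvg) _ _.
  by move=> eps eps0 x Ox; apply: cvgN; exact: cont.
by move=> eps /hsol[_ super]; exact: supersolutionN.
Qed.
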